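(* Let $N'\ge 0$ be an integer, let $\ket{\varphi}=\sum_{n=0}^{N'}c_n\ket{\psi_n}$ with $\sum_n|c_n|^2=1$, and let either $\ket{\varphi'}=\sum_{n=0}^{N'}c'_n\ket{\psi_n}$ with $\sum_n|c'_n|^2=1$, or $\ket{\varphi'}=(2\pi/N)^{1/4}\ket{x_j}$ for some $j$. Define the discrete states $\ket{\varphi^{\rm d}}\propto\sum_{n=0}^{N'}c_n\ket{\psi_n^{\rm d}}$ and, respectively, $\ket{\varphi'^{\rm d}}\propto\sum_{n=0}^{N'}c'_n\ket{\psi_n^{\rm d}}$ or $\ket{\varphi'^{\rm d}}=\ket{j}$ (normalized). Let $t$ be the evolution time and $\epsilon>0$ a precision parameter, and assume $|t|>1$ and $t=O(1)$. Then there exists $N=O(\log(1/\epsilon)+N')$ such that $$\left|\bra{\varphi'^{\rm d}}U^{\rm d}(t)\ket{\varphi^{\rm d}}-\bra{\varphi'}U(t)\ket{\varphi}\right|=O(\epsilon).$$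
   Context: Hermite functions: $\psi_n(x)=(n!\,2^n\sqrt\pi)^{-1/2}e^{-x^2/2}H_n(x)$, $H_n$ the physicists' Hermite polynomial. The continuous quantum harmonic oscillator is $H=\frac12(\hat x^2+\hat p^2)$ on $L^2(\mathbb R)$ with eigenstates $\ket{\psi_n}$ ($\langle x|\psi_n\rangle=\psi_n(x)$), eigenvalues $n+1/2$, and $U(t)=e^{-iHt}$; $\ket{x}$ denotes the (generalized) eigenstate of $\hat x$ with eigenvalue $x$. Discrete QHO: $N\ge2$ even, orthonormal basis $\ket{j}$, $j\in\{-N/2,\dots,N/2-1\}$, $x_j=j\sqrt{2\pi/N}$; $x^{\rm d}=\mathrm{diag}(x_j)$; the centered discrete Fourier transform $F^{\rm d}_{\rm c}$ has entries $[F^{\rm d}_{\rm c}]_{j,k}=N^{-1/2}e^{i2\pi jk/N}$; $p^{\rm d}=(F^{\rm d}_{\rm c})^{-1}x^{\rm d}F^{\rm d}_{\rm c}$; $H^{\rm d}=\frac12((x^{\rm d})^2+(p^{\rm d})^2)$; $U^{\rm d}(t)=e^{-iH^{\rm d}t}$. Discrete Hermite states (unnormalized): $\ket{\psi_n^{\rm d}}=(2\pi/N)^{1/4}\sum_{j=-N/2}^{N/2-1}\psi_n(x_j)\ket{j}$. Order notation is asymptotic. *)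

(* Defs.v *)
From HB Require Import structures.
From mathcomp Require Import all_boot all_order all_algebra.
From mathcomp Require Import all_classical all_reals all_analysis.
From mathcomp Require Import complex.
Set Implicit Arguments. Unset Strict Implicit. Unset Printing Implicit Defensive.
Import Order.TTheory GRing.Theory Num.Theory.
Import numFieldNormedType.Exports.
Local Open Scope ring_scope.

Section QHO.
Variable R : realType.
Local Notation C := (complex R).

Definition cR (x : R) : C := Complex x 0.
Definition iunit : C := Complex 0 1.
Definition expi (th : R) : C := Complex (cos th) (sin th).
Definition cmod (z : C) : R := Num.sqrt (complex.Re z ^+ 2 + complex.Im z ^+ 2).

Fixpoint hermite (n : nat) (x : R) : R :=
  match n with
  | 0 => 1
  | 1 => 2 * x
  | S (S m as k) => 2 * x * hermite k x - 2 * k%:R * hermite m x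
  end.

Definition psi (n : nat) (x : R) : R :=
  (Num.sqrt (n`!%:R * 2 ^+ n * Num.sqrt pi))^-1 * expR (- (x ^+ 2) / 2)
  * hermite n x.

Definition wavefun (N' : nat) (c : nat -> C) (x : R) : C :=
  \sum_(n < N'.+1) c n * cR (psi n x).

(* <x| U(t) |phi>, where U(t) psi_n = e^{-i(n+1/2)t} psi_n
   (psi_n eigenstate of H with eigenvalue n + 1/2) *)
Definition evolved (N' : nat) (c : nat -> C) (t : R) (x : R) : C :=
  \sum_(n < N'.+1) c n * expi (- ((n%:R + 2^-1) * t)) * cR (psi n x).

Definition L2inner (f g : R -> C) : C :=
  Complex (Rintegral lebesgue_measure setT (fun x => complex.Re (conjc (f x) * g x)))
          (Rintegral lebesgue_measure setT (fun x => complex.Im (conjc (f x) * g x))).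

(* centered index j = i - N/2 in {-N/2,...,N/2-1} of  i : 'I_N *)
Definition jc (N : nat) (i : 'I_N) : R := i%:R - (N./2)%:R.

Definition xgrid (N : nat) (i : 'I_N) : R := jc i * Num.sqrt (2 * pi / N%:R).

Definition xd (N : nat) : 'M[C]_N := diag_mx (\row_i cR (xgrid i)).

Definition Fdc (N : nat) : 'M[C]_N :=
  \matrix_(j, k) (cR (Num.sqrt N%:R)^-1 * expi (2 * pi * jc j * jc k / N%:R)).

Definition pd (N : nat) : 'M[C]_N := invmx (Fdc N) *m xd N *m Fdc N.

Definition Hd (N : nat) : 'M[C]_N :=
  cR (2^-1) *: (xd N *m xd N + pd N *m pd N).

Fixpoint mpow (N : nat) (A : 'M[C]_N) (k : nat) : 'M[C]_N :=
  match k with 0 => 1%:M | k'.+1 => A *m mpow A k' end.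

Definition mexp_partial (N : nat) (A : 'M[C]_N) (K : nat) : 'M[C]_N :=
  \sum_(k < K) cR (k`!%:R)^-1 *: mpow A k.

Definition mexp (N : nat) (A : 'M[C]_N) : 'M[C]_N :=
  \matrix_(i, j) Complex (limn (fun K => complex.Re (mexp_partial A K i j)))
                         (limn (fun K => complex.Im (mexp_partial A K i j))).

Definition Ud (N : nat) (t : R) : 'M[C]_N := mexp ((- (iunit * cR t)) *: Hd N).

Definition quarter_factor (N : nat) : R := Num.sqrt (Num.sqrt (2 * pi / N%:R)).

Definition psid (N n : nat) : 'cV[C]_N :=
  \col_i cR (quarter_factor N * psi n (xgrid i)).

Definition vnorm (N : nat) (v : 'cV[C]_N) : R :=
  Num.sqrt (\sum_i (complex.Re (v i 0) ^+ 2 + complex.Im (v i 0) ^+ 2)).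

Definition normalize (N : nat) (v : 'cV[C]_N) : 'cV[C]_N :=
  cR (vnorm v)^-1 *: v.

Definition phid (N N' : nat) (c : nat -> C) : 'cV[C]_N :=
  normalize (\sum_(n < N'.+1) c n *: psid N n).

Definition ket (N : nat) (j : 'I_N) : 'cV[C]_N := \col_k (if k == j then 1 else 0).

Definition braket (N : nat) (a : 'cV[C]_N) (M : 'M[C]_N) (b : 'cV[C]_N) : C :=
  \sum_i \sum_k conjc (a i 0) * M i k * b k 0.

Definition normalized (N' : nat) (c : nat -> C) : Prop :=
  \sum_(n < N'.+1) (complex.Re (c n) ^+ 2 + complex.Im (c n) ^+ 2) = 1.

End QHO.

(* Main.v *)
Require Import Defs.
From HB Require Import structures.
From mathcomp Require Import all_boot all_order all_algebra.
From mathcomp Require Import all_classical all_reals all_analysis.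
From mathcomp Require Import complex.
From mathcomp Require Import ring lra zify spectral sesquilinear measurable_realfun.
Import Order.TTheory GRing.Theory Num.Theory.
Import numFieldNormedType.Exports.
Local Open Scope ring_scope.

(* The discrete Hermite states are eigenvectors of H^d up to an exponentially
   small error, and everything else is perturbation theory.

   For f = (psi_n' - i y psi_n) e^{ixy} one has f' = (psi_n'' + y^2 psi_n) e^{ixy},
   so an exponentially small bound on the grid sums of f' gives
   (p^d)^2 psi_n^d ~ -(psi_n'')^d, that is H^d psi_n^d ~ (n + 1/2) psi_n^d.  To
   bound these sums without Poisson summation, let g(z) be the sum of f over the
   grid of step h shifted by z.  It is almost h-periodic, and then
   |g'| <= (h/4) sup |g''|; iterating K times bounds the sum by
   (h/4)^K sup |f^(K+1)| up to the tails, where the K-th derivative of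
   psi_n(x) cos(xy + a) is at most about (|y| + 11 sqrt K)^K by the ladder
   relations.  As h |y| <= pi on the grid and h sqrt K is small, the ratio is less
   than 9/10.

   By the spectral theorem the residual of H^d bounds the error of the evolution,
   with a factor polynomial in N.  The Gram matrix of the psi_n^d is almost the
   identity: approximate eigenvectors of the hermitian H^d for distinct
   eigenvalues are almost orthogonal, multiplication by x relates the norms of
   psi_n^d and psi_{n+1}^d, and psi_0^d is normalized up to the same grid sum
   bound, with the normal distribution function as first primitive.  The
   polynomial factors in N are absorbed by taking N a large multiple of
   log(1/eps) + N'. *)

(** * Derivatives of real functions and monotonicity *)

Section Calculus.
Context {R : realType}.
Implicit Types (f g : R -> R) (x : R).

Lemma der_eq f g x (a b : R) : is_derive x 1 f a -> f =1 g -> a = b ->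
  is_derive x 1 g b.
Proof. by move=> df /funext <- <-. Qed.

Lemma derD f g x (a b : R) : is_derive x 1 f a -> is_derive x 1 g b ->
  is_derive x 1 (fun y => f y + g y) (a + b).
Proof. by move=> df dg; exact: is_deriveD. Qed.

Lemma derB f g x (a b : R) : is_derive x 1 f a -> is_derive x 1 g b ->
  is_derive x 1 (fun y => f y - g y) (a - b).
Proof. by move=> df dg; exact: is_deriveB. Qed.

Lemma derM f g x (a b : R) : is_derive x 1 f a -> is_derive x 1 g b ->
  is_derive x 1 (fun y => f y * g y) (f x * b + a * g x).
Proof.
move=> df dg; apply: (is_derive_eq (is_deriveM df dg)).
by rewrite /GRing.scale/= (mulrC a).
Qed.

Lemma derZ (k : R) f x (a : R) : is_derive x 1 f a ->
  is_derive x 1 (fun y => k * f y) (k * a).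
Proof. by move=> df; exact: is_deriveZ. Qed.

Lemma derC (k : R) x : is_derive x 1 (fun=> k) (0 : R).
Proof. exact: is_derive_cst. Qed.

Lemma derId x : is_derive x 1 (fun y => y) (1 : R).
Proof. exact: is_derive_id. Qed.

Lemma der_comp f g x (a b : R) : is_derive (g x) 1 f a -> is_derive x 1 g b ->
  is_derive x 1 (fun y => f (g y)) (a * b).
Proof. by move=> df dg; exact: is_derive1_comp. Qed.

Lemma der_affine (c b x : R) : is_derive x 1 (fun y => c * y + b) c.
Proof.
apply: (is_derive_eq (derD _ _ _ _ _ (derZ c _ _ _ (derId x)) (derC b x))).
by rewrite mulr1 addr0.
Qed.

Lemma der_shift f x (c a : R) : is_derive (x + c) 1 f a ->
  is_derive x 1 (fun y => f (y + c)) a.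
Proof.
move=> df; have dg := derD _ _ _ _ _ (derId x) (derC c x).
by refine (der_eq _ _ _ _ _ (der_comp f (fun y => y + c) _ _ _ df dg) _ _) => //; rewrite addr0 mulr1.
Qed.

Lemma der_sum n (f : 'I_n -> R -> R) x (d : 'I_n -> R) :
  (forall i, is_derive x 1 (f i) (d i)) ->
  is_derive x 1 (fun y => \sum_(i < n) f i y) (\sum_(i < n) d i).
Proof.
move=> df; have := is_derive_sum df; congr is_derive.
by apply/funext => y; rewrite fct_sumE.
Qed.

Lemma der_sqr x : is_derive x 1 (fun y => y ^+ 2) (2 * x).
Proof.
by apply: (der_eq _ _ _ _ _ (derM _ _ _ _ _ (derId x) (derId x))) => [y|]; ring.
Qed.

Lemma derX n x : is_derive x 1 (fun y => y ^+ n) (n%:R * x ^+ n.-1).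
Proof.
elim: n => [|[|n] IH]; first by rewrite mul0r; exact: derC.
  by rewrite expr0 mulr1; exact: derId.
refine (der_eq _ _ _ _ _ (derM _ _ _ _ _ (derId x) IH) _ _) => [y|].
  by rewrite -exprS.
by rewrite /= -[n.+2%:R]natr1 exprS; ring.
Qed.

Lemma is_derive_continuous f x a : is_derive x 1 f a -> {for x, continuous f}.
Proof. by move=> df; apply/differentiable_continuous/derivable1_diffP. Qed.

Lemma nondecreasing_der f (f' : R -> R) a b :
  (forall x, is_derive x 1 f (f' x)) -> a <= b ->
  (forall x, a <= x <= b -> 0 <= f' x) -> f a <= f b.
Proof.
move=> df ab f'0.
have [|c] := @MVT_segment R f f' a b ab.
  by apply: continuous_subspaceT => x; exact: is_derive_continuous (df x).
rewrite in_itv/= => cab E; rewrite -subr_ge0 E mulr_ge0 ?subr_ge0//.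
exact: f'0.
Qed.

Lemma nonincreasing_der f (f' : R -> R) a b :
  (forall x, is_derive x 1 f (f' x)) -> a <= b ->
  (forall x, a <= x <= b -> f' x <= 0) -> f b <= f a.
Proof.
move=> df ab f'0; rewrite -lerN2.
apply: (nondecreasing_der (fun x => - f x) (fun x => - f' x)) => // x.
  by move=> /f'0; rewrite oppr_ge0.
Qed.

End Calculus.

(** * Hermite functions *)

Section Hermite.
Context {R : realType}.
Implicit Types (x y r : R) (n : nat).

(** At [n = 0] the junk value [hermite 0.-1] is multiplied by zero, so no case distinction is
    needed. The ladder relations below use the same convention. *)
Lemma hermiteS n x :
  hermite n.+1 x = 2 * x * hermite n x - 2 * n%:R * hermite n.-1 x.
Proof. by case: n => [|n]//=; rewrite mulr0 mul0r subr0 mulr1. Qed.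

Lemma hermite_der n x : is_derive x 1 (hermite n) (2 * n%:R * hermite n.-1 x).
Proof.
elim/ltn_ind: n => -[|[|n]] IH.
- by rewrite mulr0 mul0r; exact: derC.
- by apply: (der_eq _ _ _ _ _ (derZ 2 _ _ _ (derId x))) => //=; rewrite !mulr1.
have d1 := IH n.+1 (ltnSn _); have d0 := IH n (ltnW (ltnSn _)).
apply: (der_eq _ _ _ _ _ (derB _ _ _ _ _ (derM _ _ _ _ _
  (derZ 2 _ _ _ (derId x)) d1) (derZ (2 * n.+1%:R) _ _ _ d0))) => //.
by rewrite !succnK hermiteS -!natr1; ring.
Qed.

(* Gronwall in [r] for the partial sums of [\sum_k |H_k x| r^k / k!]; the
   majorant solves the same recursion with positive signs. *)
Lemma hermite_gen_bound n x r : 0 <= r ->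
  `|hermite n x| * r ^+ n <= n`!%:R * expR (2 * `|x| * r + r ^+ 2).
Proof.
move=> r0.
pose g (k : nat) : R := `|hermite k x| / k`!%:R.
have g0 k : 0 <= g k by rewrite /g divr_ge0.
have fk k : k.+1`!%:R = k.+1%:R * k`!%:R :> R by rewrite factS natrM.
have grec k : k.+1%:R * g k.+1 <= 2 * `|x| * g k + 2 * (if k is j.+1 then g j else 0).
  have nz : k`!%:R != 0 :> R by rewrite pnatr_eq0 -lt0n fact_gt0.
  have -> : k.+1%:R * g k.+1 = `|hermite k.+1 x| / k`!%:R.
    by rewrite /g fk invfM mulrCA; congr (_ * _); rewrite mulrA divff ?mul1r ?pnatr_eq0.
  rewrite hermiteS ler_pdivrMr ?ltr0n ?fact_gt0//.
  apply: (le_trans (ler_normB _ _)); rewrite !normrM normr_nat.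
  rewrite /g [X in _ <= X]mulrDl lerD//; first by rewrite -[X in _ <= X]mulrA divfK.
  case: k nz {g0} => [|j] nz; first by rewrite normr0 !(mulr0, mul0r).
  rewrite fk [j.+1.-1]/= normr_nat; have := nz.
  rewrite fk mulf_eq0 negb_or => /andP[a b].
  rewrite le_eqVlt; apply/orP; left; apply/eqP.
  by field; rewrite b.
pose G (r : R) : R := \sum_(k < n.+1) g k * r ^+ k.
pose G' (r : R) : R := \sum_(k < n.+1) g k * (k%:R * r ^+ k.-1).
have dG (s : R) : is_derive s 1 G (G' s).
  apply: der_sum => i; apply: derZ.
  exact: derX.
(* Truncation preserves the differential inequality: the terms of the right-hand side without a
   counterpart in [G' s] are nonnegative. Its integrating factor is [E] below. *)
have G'le s : 0 <= s -> G' s <= (2 * `|x| + 2 * s) * G s.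
  move=> s0; rewrite /G' big_ord_recl mul0r mulr0 add0r.
  have -> : (2 * `|x| + 2 * s) * G s = 2 * `|x| * G s + 2 * (s * G s) by ring.
  have A : \sum_(k < n) 2 * `|x| * (g k * s ^+ k) <= 2 * `|x| * G s.
    rewrite -mulr_sumr ler_wpM2l ?mulr_ge0// /G big_ord_recr/= lerDl.
    by rewrite mulr_ge0// exprn_ge0.
  have B : \sum_(k < n) 2 * ((if k : nat is j.+1 then g j else 0) * s ^+ k) <= 2 * (s * G s).
    rewrite -mulr_sumr ler_wpM2l// /G.
    case: (n) => [|m]; first by rewrite big_ord0 !mulr_ge0// sumr_ge0// => i _;
      rewrite mulr_ge0// exprn_ge0.
    rewrite big_ord_recl/= mul0r add0r mulr_sumr big_ord_recr/=.
    apply: ler_wpDr; first by rewrite !mulr_ge0// exprn_ge0.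
    rewrite big_ord_recr/=.
    apply: ler_wpDr; first by rewrite !mulr_ge0// exprn_ge0.
    by apply: ler_sum => i _; rewrite exprS mulrCA.
  apply: (le_trans _ (lerD A B)).
  rewrite -big_split/=; apply: ler_sum => i _.
  rewrite /bump leq0n add1n add0n.
  have -> : g i.+1 * (i.+1%:R * s ^+ i) = i.+1%:R * g i.+1 * s ^+ i by ring.
  apply: (le_trans (ler_wpM2r (exprn_ge0 i s0) (grec i))).
  by rewrite mulrDl !mulrA.
pose E (s : R) : R := expR (- (2 * `|x| * s + s ^+ 2)).
have dE (s : R) : is_derive s 1 E (E s * - (2 * `|x| + 2 * s)).
  apply: (der_comp expR (fun s => - (2 * `|x| * s + s ^+ 2))).
  have := derB _ _ _ _ _ (der_affine (- (2 * `|x|)) 0 s) (der_sqr s).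
  rewrite opprD; congr is_derive; apply/funext => t; ring.
have mono : G r * E r <= G 0 * E 0.
  apply: (nonincreasing_der (fun s => G s * E s) _ 0 r (fun s => derM _ _ _ _ _ (dG s) (dE s)) r0).
  move=> s /andP[s0 _].
  have -> : G s * (E s * - (2 * `|x| + 2 * s)) + G' s * E s =
            (G' s - (2 * `|x| + 2 * s) * G s) * E s by ring.
  by rewrite mulr_le0_ge0 ?expR_ge0// subr_le0 G'le.
have G0 : G 0 = 1.
  rewrite /G big_ord_recl expr0 mulr1 big1 => [|i _]; last first.
    by rewrite /= expr0n/= mulr0.
  by rewrite /g /= normr1 divr1 addr0.
have E0 : E 0 = 1 by rewrite /E mulr0 expr0n/= addr0 oppr0 expR0.
have Gr : G r <= expR (2 * `|x| * r + r ^+ 2).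
  move: mono; rewrite G0 E0 mulr1 /E expRN -ler_pdivlMr ?invr_gt0 ?expR_gt0//.
  by rewrite invrK mul1r.
have gG : g n * r ^+ n <= G r.
  rewrite /G big_ord_recr/= lerDr sumr_ge0// => i _.
  by rewrite mulr_ge0// exprn_ge0.
have := le_trans gG Gr.
by rewrite /g mulrAC ler_pdivrMr ?ltr0n ?fact_gt0// [X in _ <= X]mulrC.
Qed.

(** The coefficients of the ladder operators, divided by sqrt 2 because position and derivative are
    their sum and difference over sqrt 2. The value [hcoef 0 = 0] removes the out-of-range index
    [0.-1]. *)
Definition hcoef (n : nat) : R := Num.sqrt (n%:R / 2).
Local Notation s := hcoef.

Lemma hcoef_ge0 n : 0 <= s n. Proof. exact: sqrtr_ge0. Qed.
Lemma hcoef0 : s 0 = 0. Proof. by rewrite /hcoef mul0r sqrtr0. Qed.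
Lemma hcoef_sqr n : s n ^+ 2 = n%:R / 2.
Proof. by rewrite sqr_sqrtr// divr_ge0. Qed.
Lemma hcoefS_gt0 n : 0 < s n.+1.
Proof. by rewrite sqrtr_gt0 divr_gt0. Qed.
Lemma hcoef_mono m n : (m <= n)%N -> s m <= s n.
Proof. by move=> mn; rewrite ler_wsqrtr// ler_pM2r ?invr_gt0// ler_nat. Qed.

Definition psi_norm n : R := (Num.sqrt (n`!%:R * 2 ^+ n * Num.sqrt pi))^-1.

Lemma sqrt_pi_gt0 : 0 < Num.sqrt (pi : R).
Proof. by rewrite sqrtr_gt0 pi_gt0. Qed.

Lemma psi_normS n : psi_norm n = 2 * s n.+1 * psi_norm n.+1.
Proof.
rewrite /psi_norm factS natrM exprS.
have -> : n.+1%:R * n`!%:R * (2 * 2 ^+ n) * Num.sqrt pi =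
  (2 * s n.+1) ^+ 2 * (n`!%:R * 2 ^+ n * Num.sqrt (pi : R)).
  by rewrite exprMn hcoef_sqr; field.
rewrite [in RHS]sqrtrM ?sqr_ge0// sqrtr_sqr ger0_norm ?mulr_ge0 ?hcoef_ge0//.
rewrite invfM mulrA divff ?mul1r// mulf_neq0// ?gt_eqF ?hcoefS_gt0//.
Qed.

Lemma psiE n x : psi n x = psi_norm n * expR (- (x ^+ 2) / 2) * hermite n x.
Proof. by []. Qed.

Lemma mulx_psi n x : x * psi n x = s n.+1 * psi n.+1 x + s n * psi n.-1 x.
Proof.
rewrite !psiE hermiteS.
case: n => [|n]; first by rewrite hcoef0 psi_normS mulr0 mul0r subr0; ring.
rewrite [n.+1.-1]/= (psi_normS n) (psi_normS n.+1).
have -> : n.+1%:R = 2 * s n.+1 ^+ 2 by rewrite hcoef_sqr; field.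
ring.
Qed.

Lemma gauss_half_der x :
  is_derive x 1 (fun y => expR (- (y ^+ 2) / 2)) (- x * expR (- (x ^+ 2) / 2)).
Proof.
apply: (der_eq _ _ _ _ _ (der_comp expR _ _ _ _ (is_derive_expR _)
  (derZ (- 2^-1) _ _ _ (der_sqr x)))) => [y|].
- by congr expR; field.
- by rewrite (_ : - 2^-1 * x ^+ 2 = - (x ^+ 2) / 2); field.
Qed.

(** [hermite_der] lowers the index, and the term [- x * psi n x] from the Gaussian factor is traded
    for neighbouring indices by [mulx_psi]. *)
Lemma psi_der n x : is_derive x 1 (psi n) (s n * psi n.-1 x - s n.+1 * psi n.+1 x).
Proof.
apply: (is_derive_eq (derM _ _ _ _ _ (derZ (psi_norm n) _ _ _ (gauss_half_der x))
  (hermite_der n x))).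
have -> : s n.+1 * psi n.+1 x = x * psi n x - s n * psi n.-1 x.
  by rewrite mulx_psi; ring.
rewrite !psiE; case: n => [|n]; first by rewrite hcoef0; ring.
rewrite [n.+1.-1]/= (psi_normS n).
have -> : n.+1%:R = 2 * s n.+1 ^+ 2 by rewrite hcoef_sqr; field.
ring.
Qed.

(** This is [hermite_gen_bound] at r = sqrt (Q / 2) / l. Completing the square, 2 |x| r <= x^2 / 4 +
    4 r^2, so half of the Gaussian decay survives at the price of exp (5 r^2). The free [l] trades
    growth in [q] against this prefactor: [l = 10] serves the grid estimates, [l = 1]
    integrability. *)
Lemma psi_bound (l Q x : R) q : 0 < l -> 0 < Q -> q%:R <= Q ->
  `|psi q x| <= l ^+ q * expR (5 * Q / (2 * l ^+ 2) - x ^+ 2 / 4).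
Proof.
move=> l0 Q0 qQ.
pose r : R := Num.sqrt (Q / 2) / l.
have r0 : 0 < r by rewrite divr_gt0// sqrtr_gt0 divr_gt0.
have r2 : r ^+ 2 = Q / (2 * l ^+ 2).
  rewrite /r expr_div_n sqr_sqrtr ?divr_ge0 ?ltW//.
  by field; rewrite gt_eqF.
have := hermite_gen_bound q x r (ltW r0).
rewrite -ler_pdivlMr ?exprn_gt0// => Hb.
have Nq : 0 <= psi_norm q by rewrite invr_ge0 sqrtr_ge0.
rewrite psiE !normrM (ger0_norm Nq) (ger0_norm (expR_ge0 _)).
apply: (le_trans (ler_wpM2l _ Hb)); first by rewrite mulr_ge0// expR_ge0.
have fq0 : 0 <= q`!%:R :> R by [].
have fact_le : q`!%:R <= Q ^+ q.
  have : (q`! <= q ^ q)%N.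
    elim: (q) => // n IH; rewrite factS expnS leq_mul2l/=.
    by apply: (leq_trans IH); case: (n) => // k; rewrite leq_exp2r // leqnSn.
  rewrite -(ler_nat R) natrX => /le_trans; apply.
  by case: (q) qQ => // k kQ; rewrite ler_pXn2r// ?nnegrE// ltW.
(* Squared and cleared of the powers of 2 and [l], this is q! / sqrt pi <= Q^q. *)
have step : psi_norm q * q`!%:R / r ^+ q <= l ^+ q.
  rewrite ler_pdivrMr ?exprn_gt0// -exprMn mulrC /r mulrCA divff ?gt_eqF// mulr1.
  rewrite -(@ler_pXn2r _ 2)// ?nnegrE ?mulr_ge0 ?exprn_ge0 ?sqrtr_ge0//.
  rewrite exprMn -exprM mulnC exprM sqr_sqrtr ?divr_ge0 ?(ltW Q0)//.
  rewrite /psi_norm exprVn sqr_sqrtr; last by rewrite !mulr_ge0 ?exprn_ge0 ?sqrtr_ge0.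
  rewrite expr_div_n.
  have p2 : 0 < (2 : R) ^+ q by rewrite exprn_gt0.
  have f0 : 0 < q`!%:R :> R by rewrite ltr0n fact_gt0.
  have sp1 : 1 <= Num.sqrt (pi : R).
    by rewrite -sqrtr1 ler_wsqrtr// (le_trans _ (pi_ge2 R))// ler1n.
  have -> : q`!%:R ^+ 2 / (q`!%:R * 2 ^+ q * Num.sqrt pi) = q`!%:R / Num.sqrt (pi:R) / 2 ^+ q.
    by field; rewrite !gt_eqF// (lt_le_trans _ sp1).
  rewrite ler_pM2r ?invr_gt0// ler_pdivrMr ?(lt_le_trans _ sp1)//.
  by rewrite (le_trans fact_le)// ler_peMr// exprn_ge0// ltW.
have -> : psi_norm q * expR (- x ^+ 2 / 2) *
    (q`!%:R * expR (2 * `|x| * r + r ^+ 2) / r ^+ q) =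
  (psi_norm q * q`!%:R / r ^+ q) * (expR (- x ^+ 2 / 2) * expR (2 * `|x| * r + r ^+ 2)).
  ring.
apply: ler_pM => //.
  by rewrite !mulr_ge0// ?invr_ge0 ?exprn_ge0 ?ltW.
rewrite -expRD ler_expR.
have -> : 5 * Q / (2 * l ^+ 2) = 5 * r ^+ 2 by rewrite r2; field; rewrite gt_eqF.
have := sqr_ge0 (`|x| / 2 - 2 * r); have : `|x| ^+ 2 = x ^+ 2 by rewrite real_normK// num_real.
move=> <-; nra.
Qed.

End Hermite.

(** * Grid sums of derivatives *)

Section GridSums.
Context {R : realType}.
Implicit Types (x y h z w : R).

(** Integrating [- A <= g2] twice. Only one side and one direction are stated, since the other
    bounds follow by reflecting the function or its argument. *)
Lemma taylor2_ge (g g1 g2 : R -> R) (x u A : R) :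
  (forall z, is_derive z 1 g (g1 z)) -> (forall z, is_derive z 1 g1 (g2 z)) ->
  0 <= u -> (forall z, x <= z <= x + u -> - A <= g2 z) ->
  g x + g1 x * u - A * u ^+ 2 / 2 <= g (x + u).
Proof.
move=> dg dg1 u0 g2A.
have g1A v : 0 <= v <= u -> g1 x - A * v <= g1 (x + v).
  move=> /andP[v0 vu].
  pose F z := g1 z + (A * z + 0).
  have dF z : is_derive z 1 F (g2 z + A).
    by have := derD _ _ _ _ _ (dg1 z) (der_affine A 0 z).
  have := nondecreasing_der F (fun z => g2 z + A) x (x + v) dF.
  rewrite lerDl => /(_ v0); rewrite /F => FF.
  have : g1 x + (A * x + 0) <= g1 (x + v) + (A * (x + v) + 0).
    apply: FF => z /andP[xz zv]; rewrite -lerBlDr sub0r; apply: g2A.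
    by rewrite xz (le_trans zv)// lerD2l.
  lra.
pose F z := g (z + x) + (A / 2 * z ^+ 2 - (g1 x * z + 0)).
pose F' z := g1 (z + x) + (A / 2 * (2 * z) - g1 x).
have dF z : is_derive z 1 F (F' z).
  apply: derD; first exact: der_shift (dg _).
  by apply: derB; [exact: derZ (der_sqr z)|exact: der_affine].
have := nondecreasing_der F F' 0 u dF u0.
have F'0 z : 0 <= z <= u -> 0 <= F' z.
  by move=> /g1A; rewrite /F' [z + x]addrC; lra.
move=> /(_ F'0); rewrite /F add0r [u + x]addrC; lra.
Qed.

(* The factor [h / 4] is the norm of the mean-free antiderivative on functions
   of period [h]; [d] accounts for the lack of exact periodicity. *)
Lemma midpoint_bound (g g1 g2 : R -> R) (x h A d : R) :
  (forall z, is_derive z 1 g (g1 z)) -> (forall z, is_derive z 1 g1 (g2 z)) ->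
  0 < h -> (forall z, `|z - x| <= h / 2 -> `|g2 z| <= A) ->
  `|g (x + h / 2) - g (x - h / 2)| <= h * d ->
  `|g1 x| <= h / 4 * A + d.
Proof.
move=> dg dg1 h0 g2A gd.
have u0 : 0 <= h / 2 by rewrite divr_ge0// ltW.
have N1 (f f' : R -> R) z : is_derive z 1 f (f' z) -> is_derive z 1 (fun z => - f z) (- f' z).
  by move=> df; refine (der_eq _ _ _ _ _ (derZ (-1) _ _ _ df) _ _) => [w|]; rewrite mulN1r.
have R1 (f f' : R -> R) z : (forall w, is_derive w 1 f (f' w)) ->
    is_derive z 1 (fun z => f (- z)) (- f' (- z)).
  move=> df.
  have dn : is_derive z 1 (fun y => -1 * y + 0) (-1) by exact: der_affine.
  by refine (der_eq _ _ _ _ _ (der_comp f (fun y => -1 * y + 0) _ _ _ (df _) dn) _ _) => [w|];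
    rewrite addr0 mulN1r// mulrN1.
have bnd z : `|z - x| <= h / 2 -> - A <= g2 z /\ - A <= - g2 z.
  by move=> /g2A; rewrite ler_norml => /andP[? ?]; rewrite lerN2.
(* [T1] to [T4] apply the Taylor bound to [g] and [- g], to the right and to the left of [x]. In the
   difference of the two end values [g x] cancels, which leaves [h * g1 x] up to
   [A * h ^+ 2 / 4]. *)
have T1 := taylor2_ge g g1 g2 x (h / 2) A dg dg1 u0.
have T2 := taylor2_ge (fun z => - g z) (fun z => - g1 z) (fun z => - g2 z) x (h / 2) A
  (fun z => N1 _ _ _ (dg z)) (fun z => N1 _ _ _ (dg1 z)) u0.
have dr z : is_derive z 1 (fun z => g (- z)) (- g1 (- z)) by exact: R1.
have dr1 z : is_derive z 1 (fun z => - g1 (- z)) (g2 (- z)).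
  by rewrite -[g2 _]opprK; apply: (N1 (fun z => g1 (- z)) (fun z => - g2 (- z))); exact: R1.
have T3 := taylor2_ge (fun z => g (- z)) (fun z => - g1 (- z)) (fun z => g2 (- z))
  (- x) (h / 2) A dr dr1 u0.
have dr2 z : is_derive z 1 (fun z => - g (- z)) (g1 (- z)).
  by rewrite -[g1 _]opprK; apply: (N1 (fun z => g (- z)) (fun z => - g1 (- z))); exact: R1.
have dr3 z : is_derive z 1 (fun z => g1 (- z)) (- g2 (- z)) by exact: R1.
have T4 := taylor2_ge (fun z => - g (- z)) (fun z => g1 (- z)) (fun z => - g2 (- z))
  (- x) (h / 2) A dr2 dr3 u0.
have i1 z : x <= z <= x + h / 2 -> `|z - x| <= h / 2.
  by move=> /andP[a b]; rewrite ler_norml; lra.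
have i2 z : - x <= z <= - x + h / 2 -> `|- z - x| <= h / 2.
  by move=> /andP[a b]; rewrite ler_norml; lra.
have {}T1 := T1 (fun z zx => (bnd z (i1 z zx)).1).
have {}T2 := T2 (fun z zx => (bnd z (i1 z zx)).2).
have {}T3 := T3 (fun z zx => (bnd _ (i2 z zx)).1).
have {}T4 := T4 (fun z zx => (bnd _ (i2 z zx)).2).
move: T1 T2 T3 T4; rewrite !opprK.
have -> : - (- x + h / 2) = x - h / 2 by ring.
move: gd; rewrite !ler_norml => /andP[gd1 gd2] T1 T2 T3 T4.
rewrite -(ler_pM2l h0) -[X in _ && X](ler_pM2l h0).
by apply/andP; split; nra.
Qed.

(** Each use of [midpoint_bound] descends one derivative and gains a factor h / 4, but consumes a
    margin h / 2 on both sides; hence the range K h / 2 for the top derivative. The weights (h /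
    4)^k in the last hypothesis make every step contribute exactly [d]. *)
Lemma midpoint_iter (g : nat -> R -> R) (h M d : R) (K : nat) :
  (forall k z, is_derive z 1 (g k) (g k.+1 z)) -> 0 < h ->
  (forall z, `|z| <= K%:R * h / 2 -> `|g K.+1 z| <= M) ->
  (forall k z, (k < K)%N -> `|z| <= K%:R * h / 2 ->
     (h / 4) ^+ k * `|g k (z + h / 2) - g k (z - h / 2)| <= h * d) ->
  `|g 1%N 0| <= (h / 4) ^+ K * M + K%:R * d.
Proof.
move=> dg h0 gM gd.
have h4 : 0 < h / 4 by rewrite divr_gt0.
(* Here [m] counts the steps left up to derivative [K.+1], and the interval around [x] with margin m
   h / 2 must stay in the initial range. *)
suff H m k x : (k + m = K)%N -> `|x| + m%:R * h / 2 <= K%:R * h / 2 ->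
    (h / 4) ^+ k * `|g k.+1 x| <= (h / 4) ^+ K * M + m%:R * d.
  have := H K 0%N 0 (add0n _); rewrite normr0 add0r expr0 mul1r; exact.
elim: m k x => [|m IH] k x.
  rewrite addn0 => -> ; rewrite !mul0r !addr0 => xK.
  by rewrite ler_pM2l ?exprn_gt0// gM.
move=> kmK xK.
have hk : 0 < (h / 4) ^+ k by rewrite exprn_gt0.
have hk1 : 0 < (h / 4) ^+ k.+1 by rewrite exprn_gt0.
pose A := ((h / 4) ^+ K * M + m%:R * d) / (h / 4) ^+ k.+1.
have xK' : `|x| <= K%:R * h / 2.
  by apply: le_trans xK; rewrite lerDl !mulr_ge0// ltW.
have kK : (k < K)%N by lia.
have := midpoint_bound (g k) (g k.+1) (g k.+2) x h A (d / (h / 4) ^+ k) (dg k) (dg k.+1) h0.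
have g2 z : `|z - x| <= h / 2 -> `|g k.+2 z| <= A.
  move=> zx; rewrite /A ler_pdivlMr// mulrC; apply: IH; first by lia.
  have := ler_normD (z - x) x; rewrite subrK => zx2.
  apply: le_trans xK; have -> : m.+1%:R * h / 2 = h / 2 + m%:R * h / 2.
    by rewrite -natr1; field.
  by rewrite addrA lerD2r (le_trans zx2)// [X in _ <= X]addrC lerD2r.
move=> /(_ g2); have := gd k x kK xK'.
rewrite mulrA ler_pdivlMr// [_ * _ ^+ k]mulrC => gdk /(_ gdk) H.
rewrite -(ler_pM2l hk) in H; apply: (le_trans H).
rewrite mulrDr [_ * (d / _)]mulrC divfK ?gt_eqF// /A exprS -[m.+1%:R]natr1.
have -> : (h / 4) ^+ k * (h / 4 * (((h / 4) ^+ K * M + m%:R * d) / (h / 4 * (h / 4) ^+ k))) =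
  (h / 4) ^+ K * M + m%:R * d.
  by field; rewrite !gt_eqF.
by rewrite mulrDl mul1r addrA.
Qed.

(** The summand is [f 1], with primitive [f 0] of total increment about [c]. Shifting the grid sum
    of [f k] by one step telescopes to two end values, which lie in the tails. Subtracting the line
    of slope c / h from the sum of primitives makes it almost periodic as well. *)
Lemma grid_sum_bound (f : nat -> R -> R) (h c M d : R) (N K : nat) :
  (forall k z, is_derive z 1 (f k) (f k.+1 z)) -> 0 < h -> ~~ odd N ->
  (0 < K)%N -> (4 * K.+1 <= N)%N ->
  (forall z, `|f K.+1 z| <= M) ->
  (forall k z1 z2, (k < K)%N -> N%:R * h / 4 <= z1 -> z2 <= - (N%:R * h / 4) ->
     (h / 4) ^+ k * `|f k z1 - f k z2 - (if k is 0 then c else 0)| <= h * d) ->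
  `|\sum_(i < N) f 1%N (jc R i * h) - c / h| <= (h / 4) ^+ K * (N%:R * M) + K%:R * d.
Proof.
move=> df h0 evN K0 KN fM tail.
pose corr k z := match k with 0 => c / h * z + 0 | 1 => c / h | _ => 0 end.
pose g k z := \sum_(i < N) f k (z + jc R i * h) - corr k z.
have dg k z : is_derive z 1 (g k) (g k.+1 z).
  apply: derB; first by apply: der_sum => i; exact: der_shift (df _ _).
  by case: k => [|[|k]]; [exact: der_affine|exact: derC|exact: derC].
have N2 : N%:R = 2 * (N./2)%:R :> R.
  by rewrite -natrM mul2n -[in LHS](odd_double_half N) (negbTE evN).
have := midpoint_iter g h (N%:R * M) d K dg h0.
have -> : g 1%N 0 = \sum_(i < N) f 1%N (jc R i * h) - c / h.
  by rewrite /g/=; congr (_ - _); apply: eq_bigr => i _; rewrite add0r.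
apply.
  move=> z _; rewrite /g/=.
  rewrite -/(corr K.+1 z) (_ : corr K.+1 z = 0) ?subr0; last by case: (K) K0.
  apply: (le_trans (ler_norm_sum _ _ _)).
  rewrite -[N in N%:R]card_ord -sumr_const mulr_suml; apply: ler_sum => i _.
  by rewrite mul1r fM.
move=> k z kK zK.
pose F (i : nat) := f k (z - h / 2 + (i%:R - (N./2)%:R) * h).
have -> : g k (z + h / 2) - g k (z - h / 2) =
    F N - F 0%N - (if k is 0 then c else 0).
  have <- : \sum_(i < N) F i.+1 - \sum_(i < N) F i = F N - F 0%N.
    by rewrite -sumrB -(telescope_sumr F (leq0n N)) big_mkord.
  rewrite /g.
  have -> : corr k (z + h / 2) = corr k (z - h / 2) + (if k is 0 then c else 0).
    by case: (k) => [|[|k']] /=; rewrite ?addr0//; field; rewrite gt_eqF.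
  have -> : \sum_(i < N) f k (z + h / 2 + jc R i * h) = \sum_(i < N) F i.+1.
    by apply: eq_bigr => i _; rewrite /F /jc -natr1; congr f; field.
  have -> : \sum_(i < N) f k (z - h / 2 + jc R i * h) = \sum_(i < N) F i by [].
  move: (\sum_(i < N) F i.+1) (\sum_(i < N) F i) (corr k (z - h / 2)) => S1 S0 cc.
  by case: (k) => [|?]; ring.
(* The shift is at most (K + 1) h / 2 <= N h / 8, so both ends of the grid remain beyond N h / 4 in
   absolute value. *)
have KN' : 4 * (K%:R + 1) <= N%:R :> R by rewrite natr1 -natrM ler_nat.
move: zK; rewrite ler_norml => /andP[z1 z2].
by apply: tail => //; rewrite ?sub0r; nra.
Qed.

(* The [k]-th derivative of [psi p x * cos (x * y + th)], by the ladder relations. *)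
Definition psi_trig_der (y : R) := fix D (k p : nat) (th x : R) : R :=
  match k with
  | 0 => psi p x * cos (x * y + th)
  | k'.+1 => hcoef p * D k' p.-1 th x - hcoef p.+1 * D k' p.+1 th x
             + y * D k' p (th + pi / 2) x
  end.
Local Notation D := psi_trig_der.

(** Differentiating the cosine shifts its phase by pi / 2, so the family is closed under
    differentiation; for larger [k] the same linear combination is differentiated termwise. *)
Lemma psi_trig_derP y k p th x : is_derive x 1 (D y k p th) (D y k.+1 p th x).
Proof.
elim: k p th => [|k IH] p th; last first.
  by apply: derD.
have dc : is_derive x 1 (fun x => cos (x * y + th)) (- sin (x * y + th) * y).
  refine (der_eq _ _ _ _ _ (der_comp cos (fun x => y * x + th) _ _ _ (is_derive_cos _) (der_affine _ _ _)) _ _).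
    by move=> z; rewrite mulrC.
  by rewrite mulrC [y * x]mulrC mulrC.
refine (der_eq _ _ _ _ _ (derM _ _ _ _ _ (psi_der p x) dc) _ _) => //=.
rewrite addrA cosDpihalf; ring.
Qed.

(** With the weight 10^p a lowering costs at most 1 and a raising 10, whence the factor 11. Each
    derivative raises the index by at most one, so [Q] must dominate [p + k]. *)
Lemma psi_trig_der_bound (y B M x : R) (Q k p : nat) (th : R) :
  0 <= B -> (forall q, (q <= Q)%N -> `|psi q x| <= 10 ^+ q * B) ->
  `|y| + 11 * hcoef Q <= M -> (p + k <= Q)%N ->
  `|D y k p th x| <= 10 ^+ p * B * M ^+ k.
Proof.
move=> B0 pB yM; elim: k p th => [|k IH] p th pk.
  rewrite /= normrM expr0 mulr1.
  apply: (le_trans _ (pB p _)); last by lia.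
  rewrite ler_piMr// ler_norml cos_geN1 cos_le1//.
have M0 : 0 <= M by apply: le_trans yM; rewrite addr_ge0// mulr_ge0// hcoef_ge0.
have sp : hcoef p <= hcoef Q :> R by apply: hcoef_mono; lia.
have sp1 : hcoef p.+1 <= hcoef Q :> R by apply: hcoef_mono; lia.
have p0 := hcoef_ge0 (R := R) p; have p10 := hcoef_ge0 (R := R) p.+1.
pose T := 10 ^+ p * B * M ^+ k.
have T0 : 0 <= T by rewrite !mulr_ge0// exprn_ge0.
have pkQ q : (q <= p.+1)%N -> (q + k <= Q)%N by lia.
have b1 : hcoef p * `|D y k p.-1 th x| <= hcoef Q * T.
  rewrite /T; case: (p) p0 sp pkQ => [|q] q0 sq qkQ.
    by rewrite hcoef0 mul0r !mulr_ge0 ?exprn_ge0// hcoef_ge0.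
  apply: ler_pM => //; apply: (le_trans (IH q th _)); first by apply: qkQ; rewrite leqW.
  rewrite ler_wpM2r ?exprn_ge0// ler_wpM2r// exprS ler_peMl ?exprn_ge0//.
  by rewrite (ler_nat _ 1 10).
have b2 : hcoef p.+1 * `|D y k p.+1 th x| <= hcoef Q * (10 * T).
  apply: ler_pM => //; apply: (le_trans (IH p.+1 th _)); first exact: pkQ.
  by rewrite /T exprS !mulrA.
have b3 : `|y| * `|D y k p (th + pi / 2) x| <= `|y| * T.
  by apply: ler_wpM2l => //; apply/IH/pkQ.
have e : 10 ^+ p * B * M ^+ k.+1 = T * M by rewrite /T exprS; ring.
rewrite e.
apply: (@le_trans _ _ ((`|y| + 11 * hcoef Q) * T)); last by rewrite mulrC ler_wpM2l.
rewrite /=; apply: (le_trans (ler_normD _ _)); rewrite normrM.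
apply: (le_trans (lerD (ler_normB _ _) b3)).
rewrite !normrM (ger0_norm p0) (ger0_norm p10); lra.
Qed.

Lemma expR_inv20 : expR (20^-1) <= 20 / 19 :> R.
Proof.
have := expR_ge1Dx (- 20^-1 : R); rewrite expRN => H.
rewrite -[expR _]invrK -[20 / 19]invf_div lef_pV2 ?posrE ?invr_gt0 ?expR_gt0//; lra.
Qed.

(** The rate comes from 9/10 * 20/19 = 1 - 1/19 <= exp (- 1/19). The factor exp (K / 20) is the
    prefactor left by [psi_tail]. *)
Lemma geometric_decay x (K : nat) : 0 <= x -> x <= 9 / 10 ->
  x ^+ K * expR (K%:R / 20) <= expR (- (K%:R / 19)).
Proof.
move=> x0 x9.
have -> : expR (K%:R / 20) = expR (20^-1) ^+ K :> R by rewrite -expRM_natl.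
have -> : expR (- (K%:R / 19)) = expR (- 19^-1) ^+ K :> R.
  by rewrite -mulrN -expRM_natl.
have xe0 : 0 <= x * expR 20^-1 := mulr_ge0 x0 (expR_ge0 _).
rewrite -exprMn; apply: lerXn2r; rewrite ?nnegrE ?expR_ge0//.
apply: (le_trans (ler_pM x0 (expR_ge0 _) x9 expR_inv20)).
by apply: le_trans (expR_ge1Dx _); lra.
Qed.

Lemma psi_tail (K q : nat) (z : R) : (q <= 2 * K)%N -> (0 < K)%N ->
  `|psi q z| <= 10 ^+ q * expR (K%:R / 20 - z ^+ 2 / 4).
Proof.
move=> qK K0.
have := psi_bound 10 (2 * K%:R) z q; rewrite -natrM => H.
apply: (le_trans (H _ _ _)) => //; rewrite ?ltr0n ?muln_gt0// ?ler_nat//.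
suff -> : 5 * (2 * K)%:R / (2 * 10 ^+ 2) = K%:R / 20 :> R by [].
by rewrite natrM; field.
Qed.

(** [grid_sum_bound] with [c = 0], because the primitive vanishes at both ends. The threshold 18/5
    is four times the ratio 9/10 of [geometric_decay]; the last hypothesis turns exp (K / 20 - z^2 /
    4) into at most exp (- K) in the tails. *)
Lemma grid_psi_trig (h y : R) (N K p : nat) (th : R) :
  0 < h -> ~~ odd N -> (p < K)%N -> (4 * K.+1 <= N)%N ->
  h * (`|y| + 11 * hcoef (2 * K)) <= 18 / 5 ->
  8 * K%:R <= (N%:R * h / 4) ^+ 2 ->
  `|\sum_(i < N) D y 1 p th (jc R i * h)| <=
    10 ^+ p * expR (- (K%:R / 19)) * (6 * N%:R / h).
Proof.
move=> h0 evN pK KN hM hN.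
have KN4 : (4 * K <= N)%N by apply: leq_trans KN; rewrite leq_mul2l leqnSn orbT.
have pk2 k : (k <= K.+1)%N -> (p + k <= 2 * K)%N by lia.
set M0 := `|y| + _ in hM.
have M00 : 0 <= M0 by rewrite addr_ge0// mulr_ge0// hcoef_ge0.
have K0 : (0 < K)%N by lia.
have hM1 : h / 4 * M0 <= 9 / 10 by lra.
have hM0 : 0 <= h / 4 * M0 by rewrite mulr_ge0// divr_ge0// ltW.
have h4k k : 0 <= (h / 4) ^+ k by rewrite exprn_ge0// divr_ge0// ltW.
have tailD k z : (k < K)%N -> (N%:R * h / 4) ^+ 2 <= z ^+ 2 ->
    (h / 4) ^+ k * `|D y k p th z| <= 10 ^+ p * expR (- K%:R).
  move=> kK zN.
  have := psi_trig_der_bound y (expR (- K%:R)) M0 z (2 * K) k p th (expR_ge0 _) _ (lexx _) _.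
  move=> H; apply: (le_trans (ler_wpM2l (h4k k) (H _ _))); [|exact: pk2 (leqW (ltnW kK))|].
    move=> q qK; apply: (le_trans (psi_tail _ _ _ qK K0)).
    rewrite ler_wpM2l ?exprn_ge0// ler_expR.
    have : 0 <= K%:R :> R by [].
    lra.
  rewrite mulrCA ler_piMr ?mulr_ge0 ?expR_ge0 ?exprn_ge0// -exprMn exprn_ile1//.
  by apply: le_trans hM1 _; lra.
have := grid_sum_bound (fun k => D y k p th) h 0
  (10 ^+ p * expR (K%:R / 20) * M0 ^+ K.+1) (2 * (10 ^+ p * expR (- K%:R)) / h) N K
  (fun k => psi_trig_derP y k p th) h0 evN K0 KN.
rewrite mul0r subr0 => H.
apply: (le_trans (H _ _)).
- move=> z; apply: psi_trig_der_bound (lexx _) _; rewrite ?expR_ge0//; last exact: pk2.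
  move=> q qK; apply: (le_trans (psi_tail _ _ _ qK K0)).
  by rewrite ler_wpM2l ?exprn_ge0// ler_expR gerBl divr_ge0// sqr_ge0.
- move=> k z1 z2 kK z1N z2N.
  have Nh0 : 0 <= N%:R * h / 4 by rewrite divr_ge0// mulr_ge0// ltW.
  have -> : (if k is 0 then 0 else 0) = 0 :> R by case: (k).
  rewrite subr0 [X in _ <= X]mulrC divfK ?gt_eqF//.
  apply: (le_trans (ler_wpM2l (h4k k) (ler_normB _ _))); rewrite mulrDr.
  have t1 := tailD k z1 kK; have t2 := tailD k z2 kK.
  have := t1 _; have := t2 _ => {}t2 {}t1.
  have z1s : (N%:R * h / 4) ^+ 2 <= z1 ^+ 2.
    by rewrite ler_pXn2r ?nnegrE// (le_trans Nh0).
  have z2s : (N%:R * h / 4) ^+ 2 <= z2 ^+ 2.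
    have z2N' : N%:R * h / 4 <= - z2 by rewrite lerNr.
    by rewrite -[z2 ^+ 2]sqrrN ler_pXn2r ?nnegrE// (le_trans Nh0).
  by have := t1 z1s; have := t2 z2s; lra.
have expK : (h / 4) ^+ K * M0 ^+ K * expR (K%:R / 20) <= expR (- (K%:R / 19)).
  by rewrite -exprMn; exact: geometric_decay.
have expK2 : expR (- K%:R) <= expR (- (K%:R / 19)) :> R.
  by rewrite ler_expR lerN2 ler_piMr//; lra.
have -> : (h / 4) ^+ K * (N%:R * (10 ^+ p * expR (K%:R / 20) * M0 ^+ K.+1)) =
  10 ^+ p * N%:R * M0 * ((h / 4) ^+ K * M0 ^+ K * expR (K%:R / 20)).
  by rewrite exprS; ring.
have p10 : 0 <= 10 ^+ p :> R by rewrite exprn_ge0.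
have M0h : M0 <= 18 / 5 / h by rewrite ler_pdivlMr// mulrC.
have E0 := expR_ge0 (- (K%:R / 19) : R).
have A1 : 10 ^+ p * N%:R * M0 * ((h / 4) ^+ K * M0 ^+ K * expR (K%:R / 20)) <=
   10 ^+ p * N%:R * (18 / 5 / h) * expR (- (K%:R / 19)).
  apply: (ler_pM _ _ _ expK).
  - exact: mulr_ge0 (mulr_ge0 p10 (ler0n _ _)) M00.
  - by rewrite -exprMn; exact: mulr_ge0 (exprn_ge0 _ hM0) (expR_ge0 _).
  - by rewrite ler_wpM2l// mulr_ge0.
have A2 : K%:R * (2 * (10 ^+ p * expR (- K%:R)) / h) <=
    N%:R / 4 * (2 * (10 ^+ p * expR (- (K%:R / 19))) / h).
  apply: ler_pM => //; rewrite ?divr_ge0 ?mulr_ge0 ?expR_ge0 ?(ltW h0)//.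
    by move: KN4; rewrite -(ler_nat R) natrM; lra.
  by rewrite ler_pM2r ?invr_gt0// ler_wpM2l// ler_wpM2l.
apply: (le_trans (lerD A1 A2)).
have -> : 10 ^+ p * expR (- (K%:R / 19)) * (6 * N%:R / h) =
   10 ^+ p * N%:R * (18 / 5 / h) * expR (- (K%:R / 19)) +
   (10 ^+ p * expR (- (K%:R / 19))) * (12 / 5 * N%:R / h) by field; rewrite gt_eqF.
rewrite lerD2l.
have -> : N%:R / 4 * (2 * (10 ^+ p * expR (- (K%:R / 19))) / h) =
  (10 ^+ p * expR (- (K%:R / 19))) * (1 / 2 * N%:R / h) by field; rewrite gt_eqF.
rewrite ler_wpM2l ?mulr_ge0// ler_pM2r ?invr_gt0// ler_wpM2r//; lra.
Qed.

End GridSums.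

(** * Evolution generated by a hermitian matrix *)

Section ComplexNumbers.
Local Open Scope sesquilinear_scope.
Context {R : realType}.
Local Notation C := (complex R).
Implicit Types (z w : C) (x y a b : R).

Lemma cmodM z w : cmod (z * w) = cmod z * cmod w.
Proof. by have := ComplexField.Normc.normcM z w; case: z; case: w. Qed.

Lemma cmod_ge0 z : 0 <= cmod z. Proof. exact: sqrtr_ge0. Qed.

Lemma cmodD z w : cmod (z + w) <= cmod z + cmod w.
Proof. by have := le_normcD z w; case: z; case: w. Qed.

Lemma cmodN z : cmod (- z) = cmod z.
Proof. by case: z => a b; rewrite /cmod /= !sqrrN. Qed.

Lemma cmodB z w : cmod (z - w) <= cmod z + cmod w.
Proof. by rewrite -[cmod w]cmodN cmodD. Qed.

Lemma cmod0 : cmod (0 : C) = 0.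
Proof. by rewrite /cmod /= expr0n/= addr0 sqrtr0. Qed.

Lemma cmod_conj z : cmod (conjc z) = cmod z.
Proof. by case: z => a b; rewrite /cmod /= sqrrN. Qed.

Lemma cmod_cR x : cmod (cR x) = `|x|.
Proof. by rewrite /cmod /= expr0n/= addr0 sqrtr_sqr. Qed.

Lemma cmod_expi x : cmod (expi x) = 1.
Proof. by rewrite /cmod /= cos2Dsin2 sqrtr1. Qed.

Lemma cmod_sum (I : Type) (r : seq I) (P : pred I) (F : I -> C) :
  cmod (\sum_(i <- r | P i) F i) <= \sum_(i <- r | P i) cmod (F i).
Proof.
elim/big_ind2: _ => [|x1 x2 y1 y2 h1 h2|//]; first by rewrite cmod0.
by rewrite (le_trans (cmodD _ _))// lerD.
Qed.

Lemma cmod_sqr z : cmod z ^+ 2 = complex.Re z ^+ 2 + complex.Im z ^+ 2.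
Proof. by rewrite sqr_sqrtr// addr_ge0// sqr_ge0. Qed.

Lemma cmod_ReIm z : cmod z <= `|complex.Re z| + `|complex.Im z|.
Proof.
rewrite -(@ler_pXn2r _ 2) ?nnegrE ?cmod_ge0 ?addr_ge0// cmod_sqr sqrrD.
rewrite -[complex.Re z ^+ 2]real_normK ?num_real// -[complex.Im z ^+ 2]real_normK ?num_real//.
by rewrite lerD2r lerDl mulrn_wge0// mulr_ge0.
Qed.

Lemma cRD x y : cR (x + y) = cR x + cR y.
Proof. by rewrite /cR; congr Complex; rewrite addr0. Qed.

Lemma cRM x y : cR (x * y) = cR x * cR y.
Proof. by rewrite /cR; congr Complex; rewrite !(mulr0, mul0r, subr0, addr0). Qed.

Lemma cRN x : cR (- x) = - cR x.
Proof. by rewrite /cR; congr Complex; rewrite oppr0. Qed.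

Lemma cRB x y : cR (x - y) = cR x - cR y.
Proof. by rewrite cRD cRN. Qed.

Lemma cR1 : cR (1 : R) = 1. Proof. by []. Qed.

Lemma cR_sum (I : Type) (r : seq I) (P : pred I) (F : I -> R) :
  cR (\sum_(i <- r | P i) F i) = \sum_(i <- r | P i) cR (F i).
Proof. by elim/big_rec2: _ => // i y1 y2 _ <-; rewrite cRD. Qed.

Lemma expiD x y : expi (x + y) = expi x * expi y.
Proof. by rewrite /expi cosD sinD; congr Complex; rewrite addrC. Qed.

Lemma expi0 : expi (0 : R) = 1.
Proof. by rewrite /expi cos0 sin0. Qed.

Lemma expiN x : expi (- x) = conjc (expi x).
Proof. by rewrite /expi cosN sinN. Qed.

Lemma expi_2pi (n : nat) : expi (2 * pi * n%:R : R) = 1.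
Proof.
elim: n => [|n IH]; first by rewrite mulr0 expi0.
by rewrite -[n.+1%:R]natr1 mulrDr expiD IH mul1r mulr1 /expi mulr_natl cos2pi sin2pi.
Qed.

(** Cosine and sine are each 1-Lipschitz, by monotonicity of f(z) + z and f(z) - z; adding the
    coordinates gives the constant 2. *)
Lemma expi_lipschitz x y : cmod (expi x - expi y) <= 2 * `|x - y|.
Proof.
wlog yx : x y / y <= x.
  move=> H; have [/H//|/ltW/H] := leP y x.
  by rewrite -cmodN opprB distrC.
have lip (f f' : R -> R) : (forall z : R, is_derive z 1 f (f' z)) ->
    (forall z : R, `|f' z| <= 1) -> `|f x - f y| <= x - y.
  move=> df f1; rewrite ler_norml; apply/andP; split.
    have := nondecreasing_der (fun z : R => f z + (1 * z + 0)) (fun z : R => f' z + 1) y x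
      (fun z : R => derD _ _ _ _ _ (df z) (der_affine 1 0 z)) yx.
    move=> /(_ _); rewrite !addr0 !mul1r => H.
    have : f y + y <= f x + x.
      by apply: H => z _; have := f1 z; rewrite ler_norml; lra.
    lra.
  have := nonincreasing_der (fun z : R => f z - (1 * z + 0)) (fun z : R => f' z - 1) y x
      (fun z : R => derB _ _ _ _ _ (df z) (der_affine 1 0 z)) yx.
  move=> /(_ _); rewrite !addr0 !mul1r => H.
  have : f x - x <= f y - y.
    by apply: H => z _; have := f1 z; rewrite ler_norml; lra.
  lra.
apply: (le_trans (cmod_ReIm _)); rewrite [`|x - y|]ger0_norm ?subr_ge0// mulr_natl mulr2n lerD//=.
  apply: (lip cos (fun z : R => - sin z)) => z.
  by rewrite normrN ler_norml sin_geN1 sin_le1.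
by apply: (lip sin cos) => z; rewrite ler_norml cos_geN1 cos_le1.
Qed.

(** If cos x = 1, then sin (|x| / 2) = 0 by the double angle formula, but |x| / 2 lies strictly
    between 0 and pi. *)
Lemma expi_neq1 x : 0 < `|x| < 2 * pi -> expi x != 1.
Proof.
move=> /andP[x0 x2]; apply/eqP => /(congr1 (@complex.Re R)) /=.
pose y := `|x| / 2.
have -> : cos x = cos (y *+ 2).
  rewrite /y -mulr_natr divfK//.
  by have [_|_] := ger0P x; rewrite ?cosN.
have sy : 0 < sin y by apply: sin_gt0_pi; rewrite /y; lra.
rewrite cos_mulr2n; have := cos2Dsin2 y; nra.
Qed.

Local Open Scope classical_set_scope.

(* Convergence of the two coordinate sequences, the form used by [mexp]. *)
Definition ccvg (u : nat -> C) z :=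
  (fun n => complex.Re (u n)) @ \oo --> complex.Re z /\
  (fun n => complex.Im (u n)) @ \oo --> complex.Im z.

Lemma ccvgD u v z w : ccvg u z -> ccvg v w -> ccvg (fun n => u n + v n) (z + w).
Proof.
move=> [u1 u2] [v1 v2]; split.
- rewrite (_ : complex.Re (z + w) = complex.Re z + complex.Re w); last by case: z {u1 u2}; case: w {v1 v2}.
  rewrite (_ : (fun n => _) = (fun n => complex.Re (u n) + complex.Re (v n))); first exact: cvgD.
  by apply/funext => n; case: (u n); case: (v n).
- rewrite (_ : complex.Im (z + w) = complex.Im z + complex.Im w); last by case: z {u1 u2}; case: w {v1 v2}.
  rewrite (_ : (fun n => _) = (fun n => complex.Im (u n) + complex.Im (v n))); first exact: cvgD.
  by apply/funext => n; case: (u n); case: (v n).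
Qed.

Lemma ccvgM (a : C) u z : ccvg u z -> ccvg (fun n => a * u n) (a * z).
Proof.
case: a => a b [u1 u2]; split.
- rewrite (_ : complex.Re _ = a * complex.Re z - b * complex.Im z); last by case: z {u1 u2}.
  rewrite (_ : (fun n => _) = (fun n => a * complex.Re (u n) - b * complex.Im (u n))).
    by apply: cvgB; apply: cvgMr.
  by apply/funext => n; case: (u n).
- rewrite (_ : complex.Im _ = a * complex.Im z + b * complex.Re z); last by case: z {u1 u2}.
  rewrite (_ : (fun n => _) = (fun n => a * complex.Im (u n) + b * complex.Re (u n))).
    by apply: cvgD; apply: cvgMr.
  by apply/funext => n; case: (u n).
Qed.

Lemma ccvg_sum n (u : 'I_n -> nat -> C) (z : 'I_n -> C) :
  (forall i, ccvg (u i) (z i)) ->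
  ccvg (fun k => \sum_(i < n) u i k) (\sum_(i < n) z i).
Proof.
elim: n u z => [|n IH] u z uz.
  rewrite big_ord0 (_ : (fun k => _) = fun=> 0); first by split; exact: cvg_cst.
  by apply/funext => k; rewrite big_ord0.
rewrite big_ord_recl (_ : (fun k => _) = fun k => u ord0 k + \sum_(i < n) u (lift ord0 i) k).
  by apply: ccvgD => //; apply: IH.
by apply/funext => k; rewrite big_ord_recl.
Qed.

(** Even powers of i x are real and odd ones imaginary, so the partial sums coincide term by term
    with those of the series defining cosine and sine. *)
Lemma expi_series x :
  ccvg (fun K => \sum_(k < K) cR (k`!%:R^-1) * Complex 0 x ^+ k) (expi x).
Proof.
have pw k : Complex 0 x ^+ k =
    Complex ((~~ odd k)%:R * (-1) ^+ k./2 * x ^+ k) ((odd k)%:R * (-1) ^+ k.-1./2 * x ^+ k).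
  elim: k => [|k IH]; first by rewrite !expr0 /= !mul1r mul0r mul0r.
  rewrite exprS IH; apply/eqP; rewrite eq_complex /=; apply/andP; split; apply/eqP.
    rewrite !mul0r sub0r negbK; case: (boolP (odd k)) => ok /=; last by rewrite !mul0r mulr0 oppr0.
    case: k ok {IH} => // k _.
    by rewrite /= !exprS; ring.
  rewrite !mul0r add0r; case: (boolP (odd k)) => ok /=; first by rewrite !mul0r mulr0.
  by rewrite !exprS; ring.
have E K : \sum_(k < K) cR (k`!%:R^-1) * Complex 0 x ^+ k =
    Complex (series (cos_coeff x) K) (series (sin_coeff x) K).
  rewrite /series /= !big_mkord; elim: K => [|K IH]; first by rewrite !big_ord0.
  rewrite !big_ord_recr /= IH pw /cos_coeff /sin_coeff /cR.
  apply/eqP; rewrite eq_complex /=; apply/andP; split; apply/eqP; congr (_ + _);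
    by rewrite !mul0r ?subr0 ?addr0 mulrC.
split; under eq_fun do rewrite E /=.
  by rewrite /= unlock; exact: is_cvg_series_cos_coeff.
by rewrite /= unlock; exact: is_cvg_series_sin_coeff.
Qed.

End ComplexNumbers.

Lemma sum_le_const {R : realType} (N : nat) (F : 'I_N -> R) (c : R) :
  (forall i, F i <= c) -> \sum_i F i <= N%:R * c.
Proof.
move=> Fc; apply: (le_trans (ler_sum _ (fun i _ => Fc i))).
by rewrite sumr_const card_ord mulr_natl.
Qed.

Section HermitianEvolution.
Local Open Scope sesquilinear_scope.
Context {R : realType} {N : nat}.
Local Notation C := (complex R).
Implicit Types (A : 'M[C]_N) (v : 'cV[C]_N).

Lemma unitary_entry (P : 'M[C]_N) i j : P \is unitarymx -> cmod (P i j) <= 1.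
Proof.
move=> /unitarymxP /matrixP /(_ i i); rewrite !mxE eqxx => /(congr1 (@complex.Re R)).
have -> : complex.Re (\sum_j P i j * (P^t* : 'M[C]_N) j i) = \sum_j cmod (P i j) ^+ 2.
  rewrite (big_morph (@complex.Re R) (id1 := 0) (op1 := +%R)) //; last by case=> ? ? [].
  apply: eq_bigr => k _; rewrite !mxE cmod_sqr.
  by case: (P i k) => a b /=; rewrite !expr2; ring.
rewrite /= => S1.
have : cmod (P i j) ^+ 2 <= 1.
  by rewrite -S1 (bigD1 j)//= lerDl sumr_ge0// => k _; rewrite sqr_ge0.
by rewrite -[X in _ <= X](expr1n _ 2) ler_pXn2r ?nnegrE ?cmod_ge0.
Qed.

(** Powers of a conjugated diagonal matrix are conjugated diagonal powers. Every entry of the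
    partial sums is thus a fixed finite combination of scalar exponential series, and the limits in
    [mexp] can be evaluated. *)
Lemma mexp_diag (P Q : 'M[C]_N) (d : 'rV[R]_N) : P *m Q = 1%:M ->
  mexp (Q *m diag_mx (\row_l Complex 0 (d 0 l)) *m P) =
  Q *m diag_mx (\row_l expi (d 0 l)) *m P.
Proof.
move=> PQ; set D := fun k => diag_mx (\row_l Complex 0 (d 0 l) ^+ k) : 'M[C]_N.
have pw k : mpow (Q *m diag_mx (\row_l Complex 0 (d 0 l)) *m P) k = Q *m D k *m P.
  elim: k => [|k IH] /=.
    have -> : D 0%N = 1%:M.
      by apply/matrixP => i j; rewrite !mxE expr0.
    by rewrite mulmx1; apply/esym/mulmx1C.
  rewrite IH !mulmxA -[_ *m P *m Q]mulmxA PQ mulmx1 -[Q *m _ *m D k]mulmxA.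
  congr (Q *m _ *m P); apply/matrixP => i j.
  by rewrite mul_diag_mx !mxE exprS mulrnAr.
have ent (M : 'M[C]_N) (r : 'rV[C]_N) i j :
    (Q *m diag_mx r *m P) i j = \sum_l (Q i l * P l j) * r 0 l.
  by rewrite mxE; apply: eq_bigr => l _; rewrite mul_mx_diag mxE mulrAC.
apply/matrixP => i j; rewrite mxE ent//.
have cv : ccvg (fun K => mexp_partial (Q *m diag_mx (\row_l Complex 0 (d 0 l)) *m P) K i j)
    (\sum_l (Q i l * P l j) * (\row_l expi (d 0 l)) 0 l).
  rewrite (_ : (fun K => _) = fun K => \sum_l (Q i l * P l j) *
      (\sum_(k < K) cR (k`!%:R^-1) * Complex 0 (d 0 l) ^+ k)).
    by apply: ccvg_sum => l; rewrite mxE; apply: ccvgM; exact: expi_series.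
  apply/funext => K; rewrite /mexp_partial summxE.
  under [RHS]eq_bigr do rewrite mulr_sumr.
  rewrite exchange_big /=; apply: eq_bigr => k _.
  rewrite mxE pw ent// mulr_sumr; apply: eq_bigr => l _.
  by rewrite mxE mulrCA.
case: cv => c1 c2.
rewrite (cvg_lim _ c1)// (cvg_lim _ c2)//.
by case: (\sum_l _).
Qed.

(** In an eigenbasis of [A] the residual has components (d_l - E) w_l and the evolution error (exp
    (- i t d_l) - exp (- i t E)) w_l, so [expi_lipschitz] compares them. Bounds are entrywise, and
    each of the two unitary changes of basis costs a factor [N]. *)
Lemma evolution_bound A v (E t r : R) (i : 'I_N) : A^t* = A ->
  (forall k, cmod ((A *m v - cR E *: v) k 0) <= r) ->
  cmod ((mexp (- (iunit R * cR t) *: A) *m v - expi (- (E * t)) *: v) i 0)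
    <= 2 * `|t| * N%:R ^+ 2 * r.
Proof.
move=> herm res.
have hA : A \is hermsymmx.
  by apply/is_hermitianmxP; rewrite expr0 scale1r herm.
have := hermitian_normalmx hA => /orthomx_spectralP.
have := hermitian_spectral_diag_real hA.
have := spectral_unitarymx A.
set P := spectralmx A; set sp := spectral_diag A => uP /mxOverP rsp Aeq.
pose Q : 'M[C]_N := invmx P; rewrite -/Q in Aeq.
have PQ : P *m Q = 1%:M by rewrite mulmxV// unitarymx_unit.
have QP : Q *m P = 1%:M by rewrite mulVmx// unitarymx_unit.
have uQ : Q \is unitarymx.
  have -> : Q = P^t* by exact: invmx_unitary.
  by rewrite trmxC_unitary.
have uP1 a b : cmod (P a b) <= 1 := unitary_entry P a b uP.
have uQ1 a b : cmod (Q a b) <= 1 := unitary_entry Q a b uQ.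
pose d : 'rV[R]_N := \row_l complex.Re (sp 0 l).
have spE l : sp 0 l = cR (d 0 l).
  by rewrite mxE; have := RRe_real (rsp 0 l) => {1}<-.
have sA : - (iunit R * cR t) *: A = Q *m diag_mx (\row_l Complex 0 ((- t *: d) 0 l)) *m P.
  rewrite Aeq -[RHS]mulmxA -mulmxA scalemxAr scalemxAl; congr (_ *m (_ *m _)).
  apply/matrixP => a b; rewrite !mxE spE mulrnAr; congr (_ *+ _).
  rewrite /iunit /cR mxE; apply/eqP; rewrite eq_complex /=; apply/andP; split; apply/eqP; ring.
rewrite sA (mexp_diag _ _ _ PQ).
pose w := P *m v.
have Pr : P *m (A *m v - cR E *: v) = diag_mx sp *m w - cR E *: w.
  rewrite mulmxBr -scalemxAr {1}Aeq !mulmxA PQ mul1mx.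
  by rewrite -[diag_mx sp *m P *m v]mulmxA.
have cP l : cmod ((diag_mx sp *m w - cR E *: w) l 0) <= N%:R * r.
  rewrite -Pr mxE (le_trans (cmod_sum _ _ _ _))//.
  apply: sum_le_const => k; rewrite cmodM -[r]mul1r; apply: ler_pM; rewrite ?cmod_ge0//.
have -> : Q *m diag_mx (\row_l expi ((- t *: d) 0 l)) *m P *m v - expi (- (E * t)) *: v =
    Q *m (diag_mx (\row_l expi ((- t *: d) 0 l)) *m w - expi (- (E * t)) *: w).
  by rewrite mulmxBr -scalemxAr /w !mulmxA QP mul1mx.
have cl l : cmod ((diag_mx (\row_l expi ((- t *: d) 0 l)) *m w - expi (- (E * t)) *: w) l 0)
    <= 2 * `|t| * (N%:R * r).
  have -> : (diag_mx (\row_l expi ((- t *: d) 0 l)) *m w - expi (- (E * t)) *: w) l 0 =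
     (expi (- (t * d 0 l)) - expi (- (E * t))) * w l 0.
    by rewrite mul_diag_mx !mxE mulNr mulrBl.
  have := cP l.
  have -> : (diag_mx sp *m w - cR E *: w) l 0 = cR (d 0 l - E) * w l 0.
    by rewrite mul_diag_mx !mxE spE cRB mulrBl mxE.
  rewrite !cmodM cmod_cR => cPl.
  have t2 : 0 <= 2 * `|t| by rewrite mulr_ge0.
  apply: le_trans (ler_wpM2l t2 cPl); rewrite mulrA ler_wpM2r ?cmod_ge0//.
  apply: (le_trans (expi_lipschitz _ _)).
  rewrite -mulrA -normrM (_ : - (t * _) - _ = - (t * (d 0 l - E))) ?normrN//; ring.
rewrite mxE (le_trans (cmod_sum _ _ _ _))//.
have -> : 2 * `|t| * N%:R ^+ 2 * r = N%:R * (2 * `|t| * (N%:R * r)) by ring.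
apply: sum_le_const => k; rewrite cmodM -[X in _ <= X]mul1r; apply: ler_pM; rewrite ?cmod_ge0//.
Qed.

End HermitianEvolution.

(** * The centered discrete Fourier transform *)

Section CenteredDFT.
Local Open Scope sesquilinear_scope.
Context {R : realType} (N : nat).
Hypothesis N0 : (0 < N)%N.
Local Notation C := (complex R).

Lemma expi_int_sub (i j : nat) : expi (2 * pi * (i%:R - j%:R) : R) = 1.
Proof. by rewrite mulrBr expiD expiN !expi_2pi mul1r conjc1. Qed.

(** Off the diagonal, the sum [S] of powers of [expi th] is multiplied by [expi th - 1], which is
    nonzero. The product telescopes to zero because N th = 2 pi (i - j), whatever the centering. *)
Lemma Fdc_unitary : Fdc R N \is unitarymx.
Proof.
apply/unitarymxP/matrixP => i j; rewrite !mxE.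
have Nr : (N%:R : R) != 0 by rewrite pnatr_eq0 -lt0n.
pose th : R := 2 * pi * (i%:R - j%:R) / N%:R.
have term k : Fdc R N i k * ((Fdc R N)^t* : 'M[C]_N) k j =
    cR N%:R^-1 * expi (th * ((k : nat)%:R - (N./2)%:R)).
  rewrite !mxE.
  have cj (z w : C) : Num.conj (z * w) = conjc z * conjc w by exact: rmorphM.
  rewrite cj -expiN mulrACA -expiD.
  have -> : conjc (cR (Num.sqrt N%:R)^-1) = cR (Num.sqrt (N%:R : R))^-1.
    by rewrite /cR /= oppr0.
  rewrite -cRM -invfM -expr2 sqr_sqrtr//; congr (_ * expi _).
  by rewrite /th /jc; field.
under eq_bigr do rewrite term.
rewrite -mulr_sumr; have [ij|ij] := eqVneq i j.
  have -> : th = 0 by rewrite /th ij subrr mulr0 mul0r.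
  under eq_bigr do rewrite mul0r expi0.
  by rewrite sumr_const card_ord -cR1 -mulr_natr -[N%:R in X in _ * X](rmorph_nat (real_complex R)) -[_ * _]cRM mul1r mulVf.
rewrite mulr0n; apply/eqP; rewrite mulf_eq0; apply/orP; right.
set S := \sum_k _.
have e1 : expi th != 1.
  apply: expi_neq1; rewrite /th.
  have ijN : 0 < `|i%:R - j%:R : R| < N%:R.
    rewrite normr_gt0 subr_eq0 eqr_nat (inj_eq val_inj) ij /=.
    have iN : (i%:R : R) < N%:R by rewrite ltr_nat.
    have jN : (j%:R : R) < N%:R by rewrite ltr_nat.
    have i0 : 0 <= i%:R :> R by []. have j0 : 0 <= j%:R :> R by [].
    rewrite ltr_norml; lra.
  have p0 := pi_gt0 R.
  have Np : 0 < N%:R :> R by rewrite ltr0n.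
  move/andP: ijN => [ij0 ijN].
  have -> : `|2 * pi * (i%:R - j%:R) / N%:R| = 2 * pi * (`|i%:R - j%:R| / N%:R) :> R.
    rewrite !normrM normfV (ger0_norm (ltW p0)) (ger0_norm (ltW Np)) ger0_norm//; ring.
  have p2 : 0 < 2 * pi :> R by rewrite mulr_gt0.
  by rewrite mulr_gt0 ?divr_gt0//= gtr_pMr// ltr_pdivrMr// mul1r.
have : (expi th - 1) * S = 0.
  pose G (k : nat) : C := expi (th * (k%:R - (N./2)%:R)).
  have -> : (expi th - 1) * S = \sum_(k < N) (G k.+1 - G k).
    rewrite mulr_sumr; apply: eq_bigr => k _.
    by rewrite mulrBl mul1r -expiD /G -natr1; congr (expi _ - _); ring.
  rewrite -(big_mkord xpredT (fun k => G k.+1 - G k)) telescope_sumr// /G.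
  have -> : th * (N%:R - (N./2)%:R) = th * (0%:R - (N./2)%:R) + 2 * pi * (i%:R - j%:R).
    by rewrite /th; field.
  by rewrite expiD expi_int_sub mulr1 subrr.
by move/eqP; rewrite mulf_eq0 subr_eq0 (negbTE e1).
Qed.

Lemma Hd_hermitian : (Hd R N)^t* = Hd R N.
Proof.
have uF := Fdc_unitary.
have xh : (xd R N)^t* = xd R N.
  apply/matrixP => i j; rewrite !mxE eq_sym.
  have [->|] := eqVneq i j; last by rewrite !mulr0n => _; exact: conjc0.
  by rewrite !mulr1n /cR /=; congr Complex; rewrite oppr0.
have tM (A B : 'M[C]_N) : (A *m B)^t* = B^t* *m A^t*.
  by rewrite trmx_mul map_mxM.
have ph : (pd R N)^t* = pd R N.
  rewrite /pd invmx_unitary// !tM xh mulmxA; congr (_ *m _).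
  by rewrite map_trmx trmxK -map_mx_comp map_mx_id// => z; exact: conjCK.
have tZ (a : C) (A B : 'M[C]_N) : (a *: (A + B))^t* = conjc a *: (A^t* + B^t*).
  by rewrite linearZ /= map_mxZ linearD /= map_mxD.
rewrite /Hd tZ; congr (_ *: (_ + _)); first by rewrite /cR /= oppr0.
  by rewrite tM xh.
by rewrite tM ph.
Qed.

End CenteredDFT.

(** * Orthonormality of the Hermite functions *)

Section Integrals.
Local Open Scope classical_set_scope.
Context {R : realType}.
Local Notation mu := (@lebesgue_measure R).
Local Notation int f := (Rintegral mu setT f).
Local Notation integrable f := (mu.-integrable setT (EFin \o f)).
Implicit Types (f g : R -> R) (x z a b : R).

Lemma integrable_lin f g a b : integrable f -> integrable g ->
  integrable (fun x => a * f x + b * g x).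
Proof.
move=> intf intg.
have := integrableD measurableT (integrableZl measurableT a intf) (integrableZl measurableT b intg).
by apply: eq_integrable => // x _ /=; rewrite EFinD !EFinM.
Qed.

Lemma Rintegral_lin f g a b : integrable f -> integrable g ->
  int (fun x => a * f x + b * g x) = a * int f + b * int g.
Proof.
move=> intf intg; rewrite RintegralD//.
- by rewrite !RintegralZl.
- have := integrableZl measurableT a intf.
  by apply: eq_integrable => // x _ /=; rewrite EFinM.
- have := integrableZl measurableT b intg.
  by apply: eq_integrable => // x _ /=; rewrite EFinM.
Qed.

Lemma Rintegral_sum_lin n (c : 'I_n -> R) (f : 'I_n -> R -> R) :
  (forall i, integrable (f i)) ->
  integrable (fun x => \sum_(i < n) c i * f i x) /\
  int (fun x => \sum_(i < n) c i * f i x) = \sum_(i < n) c i * int (f i).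
Proof.
move=> intf; elim: n c f intf => [|n IH] c f intf.
  have E : (fun x => \sum_(i < 0) c i * f i x) = (fun x => 0).
    by apply/funext => x; rewrite big_ord0.
  rewrite E big_ord0; split.
    exact: (integrable0 mu setT).
  by rewrite Rintegral_cst// mul0r.
have [I1 I2] := IH (fun i => c (lift ord0 i)) (fun i => f (lift ord0 i)) (fun i => intf _).
have E : (fun x => \sum_(i < n.+1) c i * f i x) =
    (fun x => c ord0 * f ord0 x + 1 * \sum_(i < n) c (lift ord0 i) * f (lift ord0 i) x).
  by apply/funext => x; rewrite big_ord_recl mul1r.
rewrite E big_ord_recl -I2; split; first exact: integrable_lin.
by rewrite Rintegral_lin// mul1r.
Qed.

(** Dominated convergence with majorant |f|. Arbitrary sets allow both exhausting the line by
    growing sets and half-lines that shrink to the empty set. *)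
Lemma Rintegral_cvg_sets f (A : nat -> set R) (B : set R) :
  (forall n, measurable (A n)) -> measurable B -> integrable f ->
  (forall x, \forall n \near \oo, (x \in A n) = (x \in B)) ->
  Rintegral mu (A n) f @[n --> \oo] --> Rintegral mu B f.
Proof.
move=> mA mB intf AB.
have mf : measurable_fun setT f by apply/measurable_EFinP; case/integrableP: intf.
have mfr (D : set R) : measurable D -> measurable_fun setT (f \_ D).
  by move=> mD; apply/(measurable_restrictT _ _).1 => //; exact: measurable_funTS.
have [] := @dominated_convergence _ _ R mu setT measurableT
  (fun n => EFin \o (f \_ (A n))) (EFin \o (f \_ B)) (fun x => `|f x|%:E).
- by move=> n; apply/measurable_EFinP; exact: mfr.
- by apply/measurable_EFinP; exact: mfr.
- apply: aeW => x _ /=; apply: cvg_near_cst.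
  by near=> n; rewrite /patch (near (AB x) n).
- have := integrable_abse intf.
  by apply: eq_integrable.
- apply: aeW => x n _ /=; rewrite lee_fin /patch; case: ifP => // _.
  by rewrite normr0.
move=> intB _ cv.
under eq_fun do rewrite Rintegral_mkcond.
have -> : Rintegral mu B f = Rintegral mu setT (f \_ B) by exact: Rintegral_mkcond.
rewrite /Rintegral; apply: fine_cvg.
by rewrite fineK//; exact: integrable_fin_num.
Unshelve. all: by end_near. Qed.

Lemma continuous_integrable_le f g : continuous f -> (forall x, `|f x| <= g x) ->
  integrable g -> integrable f.
Proof.
move=> cf fg; apply: le_integrable => //.
- by apply/measurable_EFinP; exact: measurable_realfun.continuous_measurable_fun.
- by move=> x _ /=; rewrite lee_fin (le_trans (fg x))// ler_norm.
Qed.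

Lemma bound_nat (z : R) : exists m : nat, forall n, (m <= n)%N -> `|z| <= n%:R.
Proof.
exists (Num.bound `|z|) => n mn.
by rewrite (le_trans (ltW (archi_boundP (normr_ge0 z))))// ler_nat.
Qed.

Lemma Rintegral_derivative (F f : R -> R) :
  (forall x, is_derive x 1 F (f x)) -> continuous f -> integrable f ->
  F n%:R @[n --> \oo] --> (0 : R) -> F (- n%:R) @[n --> \oo] --> (0 : R) -> int f = 0.
Proof.
move=> dF cf intf F1 F2.
(* The successor keeps the interval nondegenerate, as the fundamental theorem of calculus
   requires. *)
have itvE (n : nat) : Rintegral mu `[- (n.+1%:R : R), n.+1%:R] f = F n.+1%:R - F (- n.+1%:R).
  have n0 : - n.+1%:R < n.+1%:R :> R by rewrite gtrN.
  have cF : continuous F by move=> x; exact: is_derive_continuous (dF x).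
  rewrite /Rintegral (@continuous_FTC2 _ f F _ _ n0)//.
  - exact: continuous_subspaceT.
  - split; first by move=> x _; exact: ex_derive.
    + by apply: cvg_at_right_filter; exact: cF.
    + by apply: cvg_at_left_filter; exact: cF.
  - by move=> x _; rewrite derive1E derive_val.
have c1 : Rintegral mu `[- (n.+1%:R : R), n.+1%:R] f @[n --> \oo] --> int f.
  apply: (Rintegral_cvg_sets f (fun n => `[- (n.+1%:R : R), n.+1%:R]%classic) setT) => // x.
  have [m xm] := bound_nat x.
  exists m => // n /= mn; rewrite in_setT; apply/mem_set => /=.
  by rewrite in_itv /= -ler_norml xm// leqW.
have c2 : F n.+1%:R - F (- n.+1%:R) @[n --> \oo] --> (0 - 0 : R).
  apply: cvgB.
    by have := F1; rewrite -(cvg_shiftS (fun n => F n%:R)).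
  by have := F2; rewrite -(cvg_shiftS (fun n => F (- n%:R))).
rewrite subr0 in c2.
have c3 : F n.+1%:R - F (- n.+1%:R) @[n --> \oo] --> int f.
  by apply: cvg_trans c1; apply: near_eq_cvg; near=> n; rewrite itvE.
exact: cvg_unique c3 c2.
Unshelve. all: by end_near. Qed.

Lemma continuous_psi n : continuous (@psi R n).
Proof. by move=> x; exact: is_derive_continuous (psi_der n x). Qed.

Lemma psi2_bound m n : exists2 c : R, 0 < c &
  forall x, `|psi m x * psi n x| <= c * expR (- x ^+ 2 / 2).
Proof.
pose Q : R := (m + n).+1%:R.
have Q0 : 0 < Q by [].
exists (expR (5 * Q / (2 * 1 ^+ 2)) * expR (5 * Q / (2 * 1 ^+ 2))).
  by rewrite mulr_gt0 ?expR_gt0.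
move=> x; have bm := psi_bound 1 Q x m ltr01 Q0.
have bn := psi_bound 1 Q x n ltr01 Q0.
rewrite normrM.
apply: (le_trans (ler_pM (normr_ge0 _) (normr_ge0 _) (bm _) (bn _))).
- by rewrite ler_nat leqW// leq_addr.
- by rewrite ler_nat leqW// leq_addl.
rewrite !expr1n !mul1r -!expRD ler_expR; lra.
Qed.

Lemma normal_pdf01E (x : R) :
  normal_pdf 0 1 x = (Num.sqrt (2 * pi))^-1 * expR (- x ^+ 2 / 2).
Proof.
rewrite normal_pdfE ?oner_eq0// /normal_peak /normal_fun subr0 !expr1n mul1r.
by rewrite -mulr_natl.
Qed.

Lemma integrable_pdf : integrable (normal_pdf 0 1).
Proof. exact: integrable_normal_pdf. Qed.

Lemma sqrt2pi_gt0 : 0 < Num.sqrt (2 * pi : R).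
Proof. by rewrite sqrtr_gt0 mulr_gt0 ?pi_gt0. Qed.

Lemma integrable_psi2 m n : integrable (fun x => psi m x * psi n x).
Proof.
have [c c0 pc] := psi2_bound m n.
pose k := c * Num.sqrt (2 * pi).
apply: (continuous_integrable_le _ (fun x => k * normal_pdf 0 1 x + 0 * normal_pdf 0 1 x)).
- by move=> x; apply: continuousM; exact: continuous_psi.
- move=> x; rewrite mul0r addr0 normal_pdf01E /k -mulrA mulVKf ?gt_eqF ?sqrt2pi_gt0//.
- by apply: integrable_lin; exact: integrable_pdf.
Qed.

Lemma gauss_le_inv (k : nat) : expR (- k%:R ^+ 2 / 2) <= 2 * harmonic k :> R.
Proof.
rewrite /harmonic mulNr expRN -[2 * _]invf_div lef_pV2 ?posrE ?expR_gt0//.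
apply: le_trans (expR_ge1Dx _); rewrite -natr1.
by have := sqr_ge0 (k%:R - 1 : R); have : 0 <= k%:R :> R by []; nra.
Qed.

Lemma gauss_cvg0 : expR (- k%:R ^+ 2 / 2) @[k --> \oo] --> (0 : R).
Proof.
have ch : 2 * harmonic k @[k --> \oo] --> (0 : R).
  by rewrite -[X in _ --> X](mulr0 2); apply: cvgMr; exact: cvg_harmonic.
apply: (squeeze_cvgr _ (cvg_cst (0 : R)) ch).
by near=> k; rewrite expR_ge0 gauss_le_inv.
Unshelve. all: by end_near. Qed.

(** The map [u] is [id] or negation, to treat both ends of the line at once. *)
Lemma psi2_cvg0 m n (u : R -> R) : (forall x, (u x) ^+ 2 = x ^+ 2) ->
  psi m (u k%:R) * psi n (u k%:R) @[k --> \oo] --> (0 : R).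
Proof.
move=> u2; have [c c0 pc] := psi2_bound m n.
apply: norm_cvg0.
have ch : c * expR (- k%:R ^+ 2 / 2) @[k --> \oo] --> (0 : R).
  by rewrite -[X in _ --> X](mulr0 c); apply: cvgMr; exact: gauss_cvg0.
apply: (squeeze_cvgr _ (cvg_cst (0 : R)) ch).
by near=> k; rewrite normr_ge0 /=; apply: (le_trans (pc _)); rewrite u2.
Unshelve. all: by end_near. Qed.

Definition psi_dot (m n : nat) : R := int (fun x => psi m x * psi n x).
Local Notation I := psi_dot.
Local Notation s := (@hcoef R).

Lemma psi_dotC m n : I m n = I n m.
Proof. by rewrite /psi_dot; congr Rintegral; apply/funext => x; rewrite mulrC. Qed.

Lemma psi_dot00 : I 0 0 = 1.
Proof.
have E : (fun x => psi 0 x * psi 0 x) =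
   (fun x => (Num.sqrt (pi : R))^-1 * gauss_fun x + 0 * gauss_fun x).
  apply/funext => x; rewrite /psi /= fact0 expr0 !mul1r !mulr1 mul0r addr0 mulrACA -expRD.
  rewrite -invfM -expr2 sqr_sqrtr ?sqrtr_ge0// /gauss_fun; congr (_ * expR _).
  by field.
have ig : integrable gauss_fun by exact: integrableT_gauss.
rewrite /psi_dot E Rintegral_lin// mul0r addr0 /Rintegral integralT_gauss /=.
by rewrite mulVf// gt_eqF// sqrt_pi_gt0.
Qed.

(** The raising operator is adjoint to the lowering one. This is half the sum of [eq1], where the
    integral of the derivative of [psi m * psi n] vanishes, and [eq2], where multiplication by x is
    moved from one factor to the other. *)
Lemma psi_dot_step m n : s n.+1 * I m n.+1 = s m * I m.-1 n.
Proof.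
have lin4 (a b c d : R) (p q : nat * nat) (p' q' : nat * nat) :
  let f x := (a * (psi p.1 x * psi p.2 x) + b * (psi q.1 x * psi q.2 x)) : R in
  let g x := (c * (psi p'.1 x * psi p'.2 x) + d * (psi q'.1 x * psi q'.2 x)) : R in
  [/\ integrable (fun x => 1 * f x + 1 * g x), continuous (fun x => 1 * f x + 1 * g x) &
  int (fun x => 1 * f x + 1 * g x) =
    a * I p.1 p.2 + b * I q.1 q.2 + (c * I p'.1 p'.2 + d * I q'.1 q'.2)].
  move=> f g.
  have cl (u v : R -> R) k l : continuous u -> continuous v ->
      continuous (fun x => k * u x + l * v x).
    by move=> cu cv x; apply: cvgD; apply: cvgMr; [exact: cu|exact: cv].
  have cp p0 q0 : continuous (fun x : R => psi p0 x * psi q0 x).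
    by move=> x; apply: cvgM; exact: continuous_psi.
  have i1 : integrable f by apply: integrable_lin; exact: integrable_psi2.
  have i2 : integrable g by apply: integrable_lin; exact: integrable_psi2.
  split; first exact: integrable_lin.
    by apply: (cl); apply: (cl); exact: cp.
  by rewrite Rintegral_lin// !mul1r !Rintegral_lin//; exact: integrable_psi2.
have eq1 : s n * I m n.-1 - s n.+1 * I m n.+1 + (s m * I m.-1 n - s m.+1 * I m.+1 n) = 0.
  have [i1 ci i2] := lin4 (s n) (- s n.+1) (s m) (- s m.+1) (m, n.-1) (m, n.+1) (m.-1, n) (m.+1, n).
  rewrite -!mulNr -i2; apply: (Rintegral_derivative (fun x => psi m x * psi n x) _ _ ci i1).
  - move=> x; refine (der_eq _ _ _ _ _ (derM _ _ _ _ _ (psi_der m x) (psi_der n x)) _ _) => //=.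
    ring.
  - exact: (psi2_cvg0 m n id).
  - by apply: (psi2_cvg0 m n (fun x => - x)) => x; rewrite sqrrN.
have eq2 : s m.+1 * I m.+1 n + s m * I m.-1 n + (- s n.+1 * I m n.+1 + - s n * I m n.-1) = 0.
  have [_ _ <-] := lin4 (s m.+1) (s m) (- s n.+1) (- s n) (m.+1, n) (m.-1, n) (m, n.+1) (m, n.-1).
  rewrite (_ : (fun x => _) = fun=> 0); first by rewrite Rintegral_cst// mul0r.
  apply/funext => x /=.
  have -> : 1 * (s m.+1 * (psi m.+1 x * psi n x) + s m * (psi m.-1 x * psi n x)) +
     1 * (- s n.+1 * (psi m x * psi n.+1 x) + - s n * (psi m x * psi n.-1 x)) =
     (s m.+1 * psi m.+1 x + s m * psi m.-1 x) * psi n x -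
     psi m x * (s n.+1 * psi n.+1 x + s n * psi n.-1 x) by ring.
  rewrite -!mulx_psi; ring.
lra.
Qed.

(** [psi_dot_step] lowers both indices together until one of them is 0; there [hcoef 0 = 0] kills
    every product except [psi_dot 0 0]. *)
Lemma psi_orthonormal m n : I m n = (m == n)%:R.
Proof.
have I0 k : I 0 k = (0%N == k)%:R.
  case: k => [|k]; first by rewrite psi_dot00.
  have := psi_dot_step 0 k; rewrite hcoef0 mul0r => /eqP.
  by rewrite mulf_eq0 gt_eqF ?hcoefS_gt0//= => /eqP.
elim: m n => [|m IH] [|n]; rewrite ?I0//; first by rewrite psi_dotC I0 eq_sym.
have := psi_dot_step m.+1 n; rewrite succnK IH eqSS.
have [-> |_] := eqVneq m n.
  by move/mulfI; apply; rewrite gt_eqF ?hcoefS_gt0.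
by rewrite mulr0 => /eqP; rewrite mulf_eq0 gt_eqF ?hcoefS_gt0//= => /eqP.
Qed.

(** The standard normal distribution function. In [Gauss_grid] it is the first primitive, of total
    increment 1. *)
Definition Phi (x : R) : R := Rintegral mu `]-oo, x] (normal_pdf 0 1).

Lemma Phi_der (x : R) : is_derive x 1 Phi (normal_pdf 0 1 x).
Proof.
have xx : x < x + 1 by rewrite ltrDl.
have [] := @continuous_FTC1 R (normal_pdf 0 1) -oo%O x (x + 1) xx.
- exact: integrableS (integrable_pdf).
- exact: ltNyr.
- by apply: continuous_normal_pdf; rewrite oner_eq0.
by move=> d1 d2; split; [exact: d1|rewrite -derive1E; exact: d2].
Qed.

Lemma Phi_cvgy : Phi n%:R @[n --> \oo] --> (1 : R).
Proof.
have E1 : int (normal_pdf 0 1) = 1 by rewrite /Rintegral integral_normal_pdf.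
suff : Phi n%:R @[n --> \oo] --> int (normal_pdf 0 1) by rewrite E1.
apply: (Rintegral_cvg_sets (normal_pdf 0 1) (fun n => `]-oo, n%:R]%classic) setT) => //.
  exact: integrable_pdf.
move=> x; have [m xm] := bound_nat x.
exists m => // n /= mn; rewrite in_setT; apply/mem_set => /=.
by rewrite in_itv /= (le_trans (ler_norm x))// xm.
Qed.

Lemma Phi_cvgNy : Phi (- n%:R) @[n --> \oo] --> (0 : R).
Proof.
rewrite -(Rintegral_set0 mu (normal_pdf 0 1 : R -> R)).
apply: (Rintegral_cvg_sets (normal_pdf 0 1) (fun n => `]-oo, - n%:R]%classic) set0) => //.
  exact: integrable_pdf.
move=> x; have [m xm] := bound_nat x.
exists m.+1 => // -[//|n] /= mn; rewrite in_set0; apply/negbTE/negP => /set_mem /=.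
rewrite in_itv /= -natr1 => xn; have := ler_norm (- x); rewrite normrN.
by have := xm n mn; lra.
Qed.

Lemma pdf_le (x : R) : 0 <= normal_pdf 0 1 x <= expR (- x ^+ 2 / 2).
Proof.
rewrite normal_pdf_ge0 /= normal_pdf01E ler_piMl ?expR_ge0//.
rewrite invf_le1 ?sqrt2pi_gt0// -[leLHS]sqrtr1 ler_wsqrtr//.
by have := pi_ge2 R; lra.
Qed.

Lemma cvg_le_lim (u : nat -> R) (l c : R) (m : nat) :
  u n @[n --> \oo] --> l -> (forall n, (m <= n)%N -> u n <= c) -> l <= c.
Proof.
move=> ul uc; rewrite -(cvg_lim (@Rhausdorff R) ul); apply: limr_le.
  by apply/cvg_ex; exists l.
by exists m => // n /= mn; exact: uc.
Qed.

Lemma cvg_ge_lim (u : nat -> R) (l c : R) (m : nat) :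
  u n @[n --> \oo] --> l -> (forall n, (m <= n)%N -> c <= u n) -> c <= l.
Proof.
move=> ul uc; rewrite -(cvg_lim (@Rhausdorff R) ul); apply: limr_ge.
  by apply/cvg_ex; exists l.
by exists m => // n /= mn; exact: uc.
Qed.

Lemma Phi_mono (a b : R) : a <= b -> Phi a <= Phi b.
Proof.
move=> ab; apply: (nondecreasing_der Phi (normal_pdf 0 1) a b Phi_der ab) => x _.
by case/andP: (pdf_le x).
Qed.

(** For x >= 1 the density is at most x exp (- x^2 / 2), so Phi(x) + exp (- x^2 / 2) is
    nonincreasing, with limit 1. The left tail is the mirror argument. *)
Lemma Phi_tail_right (z : R) : 1 <= z -> `|Phi z - 1| <= expR (- z ^+ 2 / 2).
Proof.
move=> z1; have [m zm] := bound_nat z.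
have P1 : Phi z <= 1.
  apply: (cvg_ge_lim _ _ _ m Phi_cvgy) => n mn; apply: Phi_mono.
  exact: le_trans (ler_norm _) (zm n mn).
rewrite distrC ger0_norm ?subr_ge0// lerBlDl.
have c : Phi n%:R + expR (- n%:R ^+ 2 / 2) @[n --> \oo] --> (1 + 0 : R).
  by apply: cvgD; [exact: Phi_cvgy|exact: gauss_cvg0].
rewrite addr0 in c; apply: (cvg_le_lim _ _ _ m c) => n mn.
have zn : z <= n%:R := le_trans (ler_norm _) (zm n mn).
apply: (nonincreasing_der (fun x => Phi x + expR (- (x ^+ 2) / 2))
  (fun x => normal_pdf 0 1 x + - x * expR (- (x ^+ 2) / 2)) z n%:R _ zn).
  by move=> x; apply: derD; [exact: Phi_der|exact: gauss_half_der].
move=> x /andP[zx _]; have /andP[_ p1] := pdf_le x.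
have := expR_ge0 (- x ^+ 2 / 2 : R); nra.
Qed.

Lemma Phi_tail_left (z : R) : z <= - 1 -> `|Phi z| <= expR (- z ^+ 2 / 2).
Proof.
move=> z1; have [m zm] := bound_nat z.
have zn n : (m <= n)%N -> - n%:R <= z.
  by move=> /zm; rewrite ler_norml => /andP[].
have P0 : 0 <= Phi z.
  by apply: (cvg_le_lim _ _ _ m Phi_cvgNy) => n mn; apply: Phi_mono; exact: zn.
rewrite ger0_norm// -subr_le0.
have c : Phi (- n%:R) - expR (- n%:R ^+ 2 / 2) @[n --> \oo] --> (0 - 0 : R).
  by apply: cvgB; [exact: Phi_cvgNy|exact: gauss_cvg0].
rewrite subr0 in c; apply: (cvg_ge_lim _ _ _ m c) => n mn.
rewrite -[in X in _ <= _ - X]sqrrN.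
apply: (nonincreasing_der (fun x => Phi x - expR (- (x ^+ 2) / 2))
  (fun x => normal_pdf 0 1 x - - x * expR (- (x ^+ 2) / 2)) (- n%:R) z _ (zn n mn)).
  by move=> x; apply: derB; [exact: Phi_der|exact: gauss_half_der].
move=> x /andP[_ zx]; have /andP[_ p1] := pdf_le x.
have := expR_ge0 (- x ^+ 2 / 2 : R); nra.
Qed.

End Integrals.

(* [h |y| <= pi] must stay below the threshold [18 / 5] of [grid_psi_trig], for
   which [pi <= 4] is not enough; hence the Taylor bound on [cos (17 / 10)]. *)
Lemma pi_lt {R : realType} : pi < 17 / 5 :> R.
Proof.
have s1 (x : R) : 0 <= x -> sin x <= x.
  move=> x0; have := nondecreasing_der (fun z : R => (1 * z + 0) - sin z) (fun z : R => 1 - cos z) 0 x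
    (fun z : R => derB _ _ _ _ _ (der_affine 1 0 z) (is_derive_sin z)) x0.
  rewrite sin0 mulr0 !addr0 subr0 mul1r => H.
  by rewrite -subr_ge0; apply: H => z _; rewrite subr_ge0 cos_le1.
have d2 (z : R) : is_derive z 1 (fun z : R => 2^-1 * z ^+ 2) z.
  by refine (der_eq _ _ _ _ _ (derZ 2^-1 _ _ _ (der_sqr z)) _ _) => //; field.
have c2 (x : R) : 0 <= x -> 1 - 2^-1 * x ^+ 2 <= cos x.
  move=> x0; have := nondecreasing_der (fun z : R => cos z + 2^-1 * z ^+ 2) (fun z : R => - sin z + z) 0 x
    (fun z : R => derD _ _ _ _ _ (is_derive_cos z) (d2 z)) x0.
  rewrite cos0 expr0n /= mulr0 addr0 => H.
  rewrite lerBlDr; apply: H => z /andP[z0 _].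
  by rewrite addrC subr_ge0 s1.
have d3 (z : R) : is_derive z 1 (fun z : R => 6^-1 * z ^+ 3) (2^-1 * z ^+ 2).
  by refine (der_eq _ _ _ _ _ (derZ 6^-1 _ _ _ (derX 3 z)) _ _) => //=; field.
have d4 (z : R) : is_derive z 1 (fun z : R => 24^-1 * z ^+ 4) (6^-1 * z ^+ 3).
  by refine (der_eq _ _ _ _ _ (derZ 24^-1 _ _ _ (derX 4 z)) _ _) => //=; field.
have s3 (x : R) : 0 <= x -> x - 6^-1 * x ^+ 3 <= sin x.
  move=> x0; have := nondecreasing_der (fun z : R => sin z + 6^-1 * z ^+ 3 - (1 * z + 0))
    (fun z : R => cos z + 2^-1 * z ^+ 2 - 1) 0 x
    (fun z : R => derB _ _ _ _ _ (derD _ _ _ _ _ (is_derive_sin z) (d3 z)) (der_affine 1 0 z)) x0.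
  rewrite sin0 expr0n /= !mulr0 !addr0 subr0 mul1r => H.
  have : 0 <= sin x + 6^-1 * x ^+ 3 - x.
    by apply: H => z /andP[z0 _]; have := c2 z z0; lra.
  lra.
have c4 (x : R) : 0 <= x -> cos x <= 1 - 2^-1 * x ^+ 2 + 24^-1 * x ^+ 4.
  move=> x0; have := nonincreasing_der (fun z : R => cos z + 2^-1 * z ^+ 2 - 24^-1 * z ^+ 4)
    (fun z : R => - sin z + z - 6^-1 * z ^+ 3) 0 x
    (fun z : R => derB _ _ _ _ _ (derD _ _ _ _ _ (is_derive_cos z) (d2 z)) (d4 z)) x0.
  rewrite cos0 !expr0n /= !mulr0 !addr0 subr0 => H.
  have : cos x + 2^-1 * x ^+ 2 - 24^-1 * x ^+ 4 <= 1.
    by apply: H => z /andP[z0 _]; have := s3 z z0; lra.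
  lra.
(* If 17/10 <= pi / 2, the cosine there is nonnegative, whereas the quartic bound [c4] is negative
   at 17/10. *)
rewrite ltNge; apply/negP => pi34.
have : 0 <= cos (17 / 10 : R) by apply: cos_ge0_pihalf; lra.
have := c4 (17 / 10) _; lra.
Qed.

(** * Discrete Hermite states *)

Section Residual.
Local Open Scope sesquilinear_scope.
Context {R : realType}.
Local Notation s := (@hcoef R).
Local Notation D := (@psi_trig_der R).

(** The oscillator equation: the left-hand side is the second derivative of [psi p], expanded by two
    uses of [psi_der]. *)
Lemma psi_second p (x : R) :
  s p * (s p.-1 * psi p.-2 x - s p * psi p x) - s p.+1 * (s p.+1 * psi p x - s p.+2 * psi p.+2 x)
  = (x ^+ 2 - (2 * p%:R + 1)) * psi p x.
Proof.
have e1 : s p * (x * psi p.-1 x) = s p * (s p * psi p x + s p.-1 * psi p.-2 x).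
  by case: p => [|p]; rewrite ?hcoef0 ?mul0r// mulx_psi.
have e2 : x ^+ 2 * psi p x = s p.+1 * (x * psi p.+1 x) + s p * (x * psi p.-1 x).
  by rewrite expr2 -mulrA mulx_psi; ring.
rewrite mulrBl e2 e1 mulx_psi succnK.
have -> : 2 * p%:R + 1 = 2 * (s p ^+ 2 + s p.+1 ^+ 2) :> R.
  by rewrite !hcoef_sqr -natr1; field.
ring.
Qed.

(** The left-hand side is the derivative of the real part of (psi_p' - i y psi_p) exp (i (x y +
    th)). The cross terms in psi_p' cancel, and [psi_second] replaces the second derivative. *)
Lemma psi_trig_residual y p th (x : R) :
  s p * D y 1 p.-1 th x - s p.+1 * D y 1 p.+1 th x - y * D y 1 p (th + pi / 2) x =
  (x ^+ 2 - (2 * p%:R + 1) + y ^+ 2) * psi p x * cos (x * y + th).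
Proof.
rewrite [RHS](_ : _ = (x ^+ 2 - (2 * p%:R + 1)) * psi p x * cos (x * y + th) +
  y ^+ 2 * psi p x * cos (x * y + th)); last by ring.
rewrite -psi_second /= !addrA !cosDpihalf sinDpihalf.
by case: p => [|p]; rewrite ?hcoef0 /=; ring.
Qed.

End Residual.

Section Discrete.
Local Open Scope sesquilinear_scope.
Context {R : realType} (N K : nat).
Hypotheses (K0 : (0 < K)%N) (evN : ~~ odd N) (KN : 150 * 200 * K%:R <= N%:R :> R).
Local Notation s := (@hcoef R).
Local Notation D := (@psi_trig_der R).
Local Notation C := (complex R).
Local Notation W := (GRing.natmul (GRing.one R) N).

Definition gstep : R := Num.sqrt (2 * pi / N%:R).
Local Notation h := gstep.

Lemma K_ge1 : 1 <= K%:R :> R. Proof. by rewrite ler1n. Qed.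

Lemma N_ge : 150 * 200 <= W.
Proof. by have := K_ge1; have := KN; lra. Qed.

Lemma N_gt0 : 0 < W. Proof. by have := N_ge; lra. Qed.

Lemma N_nat_gt0 : (0 < N)%N. Proof. by have := N_gt0; rewrite ltr0n. Qed.

Lemma KN4 : (4 * K.+1 <= N)%N.
Proof.
rewrite -(ler_nat R) natrM -[K.+1%:R]natr1; have := K_ge1; have := KN; lra.
Qed.

Lemma gstep_sqr : h ^+ 2 = 2 * pi / W.
Proof. by rewrite sqr_sqrtr// divr_ge0 ?mulr_ge0 ?pi_ge0. Qed.

Lemma gstep_gt0 : 0 < h.
Proof. by rewrite sqrtr_gt0 divr_gt0 ?mulr_gt0 ?pi_gt0 ?N_gt0. Qed.

Lemma gstep_sqrN : h ^+ 2 * W = 2 * pi.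
Proof. by rewrite gstep_sqr divfK// gt_eqF// N_gt0. Qed.

Lemma gstep_sqrK : h ^+ 2 * K%:R <= 1 / (40 * 100).
Proof.
have := gstep_sqrN; have := @pi_lt R; have := KN; have := gstep_sqr; have := sqr_ge0 h.
nra.
Qed.

Lemma gstep_le : h <= 1 / 60.
Proof.
rewrite -(@ler_pXn2r _ 2) ?nnegrE ?(ltW gstep_gt0)//.
have := gstep_sqrK; have := K_ge1; have := sqr_ge0 h; nra.
Qed.

Lemma gstepN_ge1 : 1 <= W * h.
Proof.
rewrite -(@ler_pXn2r _ 2) ?nnegrE ?expr1n ?mulr_ge0 ?(ltW gstep_gt0)//.
have -> : (W * h) ^+ 2 = W * (h ^+ 2 * W) by ring.
rewrite gstep_sqrN; have := N_ge; have := pi_ge2 R; nra.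
Qed.

(** The factor 150 * 200 between [K] and [N] is used here: with h |y| <= pi < 17/5 on the grid, the
    extra 11/60 still keeps the sum below 18/5. *)
Lemma gstep_sqrtK : h * s (2 * K) <= 1 / 60.
Proof.
rewrite -(@ler_pXn2r _ 2) ?nnegrE ?mulr_ge0 ?sqrtr_ge0//.
have -> : (h * s (2 * K)) ^+ 2 = h ^+ 2 * K%:R.
  by rewrite exprMn hcoef_sqr natrM; field.
by have := gstep_sqrK; lra.
Qed.

Lemma N_half : W = 2 * (N./2)%:R.
Proof. by rewrite -natrM mul2n -[in LHS](odd_double_half N) (negbTE evN). Qed.

Lemma jc_le (i : 'I_N) : `|jc R i| <= W / 2.
Proof.
rewrite /jc N_half ler_norml.
have : (i%:R : R) <= W by rewrite ler_nat ltnW.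
rewrite N_half; have : 0 <= i%:R :> R by []. lra.
Qed.

Lemma xgridE (i : 'I_N) : xgrid R i = jc R i * h. Proof. by []. Qed.

Lemma xgrid_le (i : 'I_N) : `|xgrid R i| <= W * h / 2.
Proof.
rewrite xgridE normrM (ger0_norm (ltW gstep_gt0)) mulrAC.
by rewrite ler_wpM2r ?(ltW gstep_gt0)// jc_le.
Qed.

(** By [psi_trig_residual] the sum is a combination of three sums bounded by [grid_psi_trig], with
    coefficients at most [N]. Each brings 6 N / h, and 1 / h <= N. *)
Lemma psi_sum_residual y p th : `|y| <= W * h / 2 -> (p.+1 < K)%N ->
  `|\sum_(i < N) (xgrid R i ^+ 2 - (2 * p%:R + 1) + y ^+ 2) * psi p (xgrid R i) *
     cos (xgrid R i * y + th)| <= 18 * W ^+ 3 * (10 ^+ p.+1 * expR (- (K%:R / 19))).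
Proof.
move=> yN pK.
have hy : h * `|y| <= pi.
  have := ler_wpM2l (ltW gstep_gt0) yN.
  have -> : h * (W * h / 2) = h ^+ 2 * W / 2 by ring.
  by rewrite gstep_sqrN; lra.
have g1 : h * (`|y| + 11 * s (2 * K)) <= 18 / 5.
  have := @pi_lt R; have := gstep_sqrtK; rewrite mulrDr mulrCA; lra.
have g2 : 8 * K%:R <= (W * h / 4) ^+ 2.
  have -> : (W * h / 4) ^+ 2 = W / 16 * (h ^+ 2 * W) by field.
  rewrite gstep_sqrN; have := KN; have := pi_ge2 R; have := K_ge1; nra.
pose e := expR (- (K%:R / 19)) * (6 * W / h).
have h0 := gstep_gt0.
have e0 : 0 <= e by rewrite mulr_ge0 ?expR_ge0// divr_ge0 ?mulr_ge0// ltW.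
have gp q th' : (q < K)%N -> (q <= p.+1)%N -> `|\sum_(i < N) D y 1 q th' (jc R i * h)| <= 10 ^+ p.+1 * e.
  move=> qK qp; apply: (le_trans (grid_psi_trig h y N K q th' h0 evN qK KN4 g1 g2)).
  by rewrite -mulrA ler_wpM2r// ler_weXn2l// (ler_nat _ 1 10).
rewrite (_ : \sum_(i < N) _ = s p * \sum_(i < N) D y 1 p.-1 th (jc R i * h) -
    s p.+1 * \sum_(i < N) D y 1 p.+1 th (jc R i * h) -
    y * \sum_(i < N) D y 1 p (th + pi / 2) (jc R i * h)); last first.
  by rewrite !mulr_sumr -!sumrB; apply: eq_bigr => i _; rewrite psi_trig_residual xgridE.
have b1 := gp p.-1 th _ _; have b2 := gp p.+1 th _ _; have b3 := gp p (th + pi / 2) _ _.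
have {}b1 := b1 (leq_ltn_trans (leq_pred p) (ltnW pK)) (leq_trans (leq_pred p) (leqnSn p)).
have {}b2 := b2 pK (leqnn _).
have {}b3 := b3 (ltnW pK) (leqnSn p).
have sp : s p.+1 <= W.
  rewrite -(@ler_pXn2r _ 2) ?nnegrE ?hcoef_ge0// hcoef_sqr.
  have : (p.+1%:R : R) <= K%:R by rewrite ler_nat ltnW.
  have := KN; have := N_ge; have := K_ge1; nra.
have sp0 : s p <= W by apply: le_trans sp; exact: hcoef_mono.
have yW : `|y| <= W.
  apply: (le_trans yN); have := gstep_le; have := N_gt0; nra.
set X := 10 ^+ p.+1 * e in b1 b2 b3.
have X0 : 0 <= X by rewrite mulr_ge0// exprn_ge0.
have t1 := ler_pM (hcoef_ge0 p) (normr_ge0 _) sp0 b1.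
have t2 := ler_pM (hcoef_ge0 p.+1) (normr_ge0 _) sp b2.
have t3 := ler_pM (normr_ge0 y) (normr_ge0 _) yW b3.
apply: (@le_trans _ _ (3 * W * X)).
  apply: (le_trans (ler_normB _ _)); apply: (le_trans (lerD (ler_normB _ _) (lexx _))).
  rewrite !normrM (ger0_norm (hcoef_ge0 p)) (ger0_norm (hcoef_ge0 p.+1)); lra.
have hinv : h^-1 <= W.
  by rewrite -[W]invrK lef_pV2 ?posrE ?invr_gt0 ?N_gt0// -[W^-1]mul1r ler_pdivrMr ?N_gt0// mulrC gstepN_ge1.
have -> : 18 * W ^+ 3 * (10 ^+ p.+1 * expR (- (K%:R / 19))) =
   18 * W ^+ 2 * (10 ^+ p.+1 * expR (- (K%:R / 19))) * W by ring.
have -> : 3 * W * X = 18 * W ^+ 2 * (10 ^+ p.+1 * expR (- (K%:R / 19))) * h^-1.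
  by rewrite /X /e; ring.
by rewrite ler_wpM2l// !mulr_ge0 ?expR_ge0 ?exprn_ge0.
Qed.

Definition res n : R := 18 * W ^+ 4 * (10 ^+ n.+1 * expR (- (K%:R / 19))).

Lemma quarter_sqr : quarter_factor R N ^+ 2 = h.
Proof. by rewrite sqr_sqrtr// sqrtr_ge0. Qed.

Lemma quarter_ge0 : 0 <= quarter_factor R N. Proof. exact: sqrtr_ge0. Qed.

Lemma quarter_le1 : quarter_factor R N <= 1.
Proof.
rewrite -(@ler_pXn2r _ 2) ?nnegrE ?quarter_ge0// quarter_sqr expr1n.
have := gstep_le; lra.
Qed.

Lemma sqrtN_inv : 0 <= (Num.sqrt W)^-1 <= 1.
Proof.
rewrite invr_ge0 sqrtr_ge0 invf_le1 ?sqrtr_gt0 ?N_gt0//.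
by rewrite -[leLHS]sqrtr1 ler_wsqrtr//; have := N_ge; lra.
Qed.

(** Since 2 pi j k / N = x_j x_k, row [j] of the Fourier transform samples exp (i x y) at y = x_j.
    Applying it to the residual therefore gives the sums of [psi_sum_residual], and transforming
    back costs one more factor [N]. *)
Lemma Hd_residual n (k : 'I_N) : (n.+1 < K)%N ->
  cmod ((Hd R N *m psid R N n - cR (n%:R + 2^-1) *: psid R N n) k 0) <= res n.
Proof.
move=> nK.
have uF := Fdc_unitary (R := R) N N_nat_gt0.
pose F := Fdc R N; pose X := xd R N; pose v := psid R N n.
have FV : invmx F *m F = 1%:M by rewrite mulVmx// unitarymx_unit.
pose w := X *m (X *m v) - cR (2 * n%:R + 1) *: v.
(* As [pd] squared is F^-1 X^2 F, twice the residual is F^-1 r. *)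
pose r := F *m w + X *m (X *m (F *m v)).
have E : Hd R N *m v - cR (n%:R + 2^-1) *: v = cR 2^-1 *: (invmx F *m r).
  rewrite /r mulmxDr [invmx F *m (F *m w)]mulmxA FV mul1mx /w /Hd /pd -/F -/X.
  rewrite -scalemxAl mulmxDl -!mulmxA [F *m (invmx F *m _)]mulmxA.
  rewrite (mulmxV (unitarymx_unit uF)) mul1mx.
  rewrite addrAC scalerBr scalerA -cRM.
  by rewrite (_ : 2^-1 * (2 * n%:R + 1) = n%:R + 2^-1 :> R); last by field.
have uFi : invmx F \is unitarymx.
  have -> : invmx F = F^t* by exact: invmx_unitary.
  by rewrite trmxC_unitary.
have rk j : cmod (r j 0) <= 36 * W ^+ 3 * (10 ^+ n.+1 * expR (- (K%:R / 19))).
  pose y := xgrid R j.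
  pose Sm th := \sum_(i < N) (xgrid R i ^+ 2 - (2 * n%:R + 1) + y ^+ 2) * psi n (xgrid R i) *
     cos (xgrid R i * y + th).
  (* The phases 0 and - pi / 2 produce the real part cos (x y) and the imaginary part sin (x y). *)
  have rE : r j 0 = cR ((Num.sqrt W)^-1 * quarter_factor R N) *
      Complex (Sm 0) (Sm (- (pi / 2))).
    have xdE (u : 'cV[C]_N) i : (X *m u) i 0 = cR (xgrid R i) * u i 0.
      by rewrite mul_diag_mx !mxE.
    have wE i : w i 0 = cR (quarter_factor R N * ((xgrid R i ^+ 2 - (2 * n%:R + 1)) * psi n (xgrid R i))).
      rewrite /w mxE !xdE [X in _ + X = _]mxE [X in _ - X = _]mxE [v _ _]mxE.
      rewrite -!cRM -cRN -cRD; congr cR; ring.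
    rewrite /r mxE !xdE [(F *m v) j 0]mxE [(F *m w) j 0]mxE !mulr_sumr -big_split /=.
    have -> : Complex (Sm 0) (Sm (- (pi / 2))) = \sum_(i < N)
       cR ((xgrid R i ^+ 2 - (2 * n%:R + 1) + y ^+ 2) * psi n (xgrid R i)) * expi (xgrid R i * y).
      rewrite /Sm; elim/big_rec3: _ => [|i z1 z2 z3 _ <-]; first by [].
      rewrite /cR /expi addr0 cosBpihalf.
      by apply/eqP; rewrite eq_complex /=; apply/andP; split; apply/eqP; ring.
    rewrite mulr_sumr; apply: eq_bigr => i _.
    rewrite wE [F j i]mxE [v i 0]mxE.
    have -> : 2 * pi * jc R j * jc R i / W = xgrid R i * y.
      rewrite /y !xgridE; have -> : jc R i * h * (jc R j * h) = jc R i * jc R j * h ^+ 2 by ring.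
      by rewrite gstep_sqr; ring.
    by rewrite -/y !(cRM, cRD, cRB); ring.
  rewrite rE cmodM cmod_cR.
  have q1 : `|(Num.sqrt W)^-1 * quarter_factor R N| <= 1.
    have /andP[a b] := sqrtN_inv.
    by rewrite ger0_norm ?mulr_ge0 ?quarter_ge0// mulr_ile1 ?quarter_ge0 ?quarter_le1.
  apply: (le_trans (ler_pM (normr_ge0 _) (cmod_ge0 _) q1 (cmod_ReIm _))); rewrite mul1r /=.
  have := psi_sum_residual y n 0 (xgrid_le j) nK.
  have := psi_sum_residual y n (- (pi / 2)) (xgrid_le j) nK.
  rewrite -!/(Sm _); lra.
rewrite E mxE cmodM cmod_cR mxE.
apply: (@le_trans _ _ (2^-1 * (W * (36 * W ^+ 3 * (10 ^+ n.+1 * expR (- (K%:R / 19))))))).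
  rewrite ger0_norm// ler_wpM2l// (le_trans (cmod_sum _ _ _ _))//.
  apply: sum_le_const => i; rewrite cmodM -[leRHS]mul1r; apply: ler_pM; rewrite ?cmod_ge0//.
  exact: unitary_entry.
by rewrite /res le_eqVlt; apply/orP; left; apply/eqP; field.
Qed.

(** Scaling the step by sqrt 2 turns the square of [psi 0] on the grid into the normal density on a
    grid of step [h']. [grid_sum_bound] then applies with primitive [Phi] and [c = 1]. *)
Lemma Gauss_grid : `|\sum_(i < N) h * (psi 0 (xgrid R i) * psi 0 (xgrid R i)) - 1| <=
  3 * W * expR (- (K%:R / 19)).
Proof.
pose h' := Num.sqrt 2 * h.
have h'0 : 0 < h' by rewrite mulr_gt0 ?gstep_gt0// sqrtr_gt0.
have h'2 : h' ^+ 2 = 2 * h ^+ 2 by rewrite exprMn sqr_sqrtr.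
have h'1 : h' <= 1.
  rewrite -(@ler_pXn2r _ 2) ?nnegrE ?(ltW h'0)// h'2 expr1n.
  by have := gstep_le; have := gstep_gt0; nra.
pose kap := (Num.sqrt (2 * pi))^-1 / psi_norm 0 : R.
have pn0 : 0 < psi_norm 0 :> R.
  by rewrite /psi_norm invr_gt0 sqrtr_gt0 fact0 expr0 !mul1r sqrt_pi_gt0.
have kap0 : 0 <= kap by rewrite divr_ge0 ?invr_ge0 ?sqrtr_ge0// ltW.
have kap1 : kap <= 1.
  rewrite -(@ler_pXn2r _ 2) ?nnegrE// expr1n /kap exprMn !exprVn.
  rewrite sqr_sqrtr ?mulr_ge0 ?pi_ge0// sqr_sqrtr ?mulr_ge0 ?exprn_ge0 ?sqrtr_ge0//.
  rewrite fact0 expr0 !mul1r invrK ler_pdivrMl ?mulr_gt0 ?pi_gt0// mulr1.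
  rewrite -(@ler_pXn2r _ 2) ?nnegrE ?sqrtr_ge0 ?mulr_ge0 ?pi_ge0//.
  by rewrite sqr_sqrtr ?pi_ge0//; have := pi_ge2 R; nra.
(* From index 1 on these are the derivatives of [psi 0], that is [psi_trig_der] with y = 0 and th =
   0. The index is shifted by one, hence the power [k.+1] in [tailD]. *)
pose f k := match k with 0 => Phi | k'.+1 => fun x => kap * D 0 k' 0 0 x end.
have pdfE (x : R) : normal_pdf 0 1 x = kap * D 0 0 0 0 x.
  rewrite normal_pdf01E /= mulr0 add0r cos0 mulr1 psiE /kap /=.
  by rewrite mulr1; field; rewrite !gt_eqF// sqrt2pi_gt0.
have df k (z : R) : is_derive z 1 (f k) (f k.+1 z).
  case: k => [|k]; first by rewrite /f -pdfE; exact: Phi_der.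
  exact/derZ/psi_trig_derP.
pose M0 := 11 * s (2 * K).
have M00 : 0 <= M0 by rewrite mulr_ge0 ?hcoef_ge0.
have hM : h' / 4 * M0 <= 9 / 10.
  have : Num.sqrt 2 <= 2 :> R.
    by rewrite -(@ler_pXn2r _ 2) ?nnegrE ?sqrtr_ge0// sqr_sqrtr// expr2; lra.
  have : 0 <= h * s (2 * K) by rewrite mulr_ge0 ?hcoef_ge0// ltW ?gstep_gt0.
  have := gstep_sqrtK; have : 0 <= Num.sqrt 2 :> R by rewrite sqrtr_ge0.
  rewrite /M0 /h'; set a := Num.sqrt 2; set b := h * _ => *.
  have -> : a * h / 4 * (11 * s (2 * K)) = a * b * (11 / 4) by rewrite /b; ring.
  nra.
have hM0 : 0 <= h' / 4 * M0 by rewrite mulr_ge0// divr_ge0// ltW.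
have X2 : 16 * K%:R <= (W * h' / 4) ^+ 2.
  have -> : (W * h' / 4) ^+ 2 = W / 16 * (h' ^+ 2 * W) by field.
  rewrite h'2 -[2 * _ * W]mulrA gstep_sqrN; have := KN; have := pi_ge2 R; have := K_ge1; nra.
have X1 : 1 <= W * h' / 4.
  rewrite -(@ler_pXn2r _ 2) ?nnegrE// ?expr1n; first by have := K_ge1; lra.
  by rewrite divr_ge0// mulr_ge0// ltW.
have KN2 (k : nat) : (k <= K)%N -> (0 + k <= 2 * K)%N.
  by move=> kK; rewrite add0n (leq_trans kK)// leq_pmull.
have h4k k : 0 <= (h' / 4) ^+ k by rewrite exprn_ge0// divr_ge0// ltW.
have zX z : W * h' / 4 <= `|z| -> 16 * K%:R <= z ^+ 2.
  move=> zX; apply: (le_trans X2); rewrite -[z ^+ 2]real_normK ?num_real//.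
  by rewrite ler_pXn2r ?nnegrE//; apply: le_trans X1.
have tailD k (z : R) : (k < K)%N -> W * h' / 4 <= `|z| ->
    (h' / 4) ^+ k.+1 * `|kap * D 0 k 0 0 z| <= expR (- K%:R).
  move=> kK /zX z2.
  have := psi_trig_der_bound 0 (expR (- K%:R)) M0 z (2 * K) k 0 0 (expR_ge0 _).
  rewrite normr0 add0r lexx => H.
  have {}H : `|D 0 k 0 0 z| <= expR (- K%:R) * M0 ^+ k.
    rewrite -[expR _]mul1r; apply: H => //; last exact: KN2 (ltnW kK).
    move=> q qK; apply: (le_trans (psi_tail _ _ _ qK K0)).
    rewrite ler_wpM2l ?exprn_ge0// ler_expR; have := K_ge1; lra.
  rewrite normrM (ger0_norm kap0).
  apply: (@le_trans _ _ ((h' / 4) ^+ k.+1 * (1 * (expR (- K%:R) * M0 ^+ k)))).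
    by rewrite ler_wpM2l// ler_pM.
  have -> : (h' / 4) ^+ k.+1 * (1 * (expR (- K%:R) * M0 ^+ k)) =
    expR (- K%:R) * ((h' / 4) * (h' / 4 * M0) ^+ k) by rewrite exprS (exprMn k (h' / 4) M0); ring.
  rewrite ler_piMr ?expR_ge0// mulr_ile1 ?exprn_ge0 ?divr_ge0 ?(ltW h'0)//; first by lra.
  by rewrite exprn_ile1//; lra.
have := grid_sum_bound f h' 1 (expR (K%:R / 20) * M0 ^+ K) (2 * expR (- K%:R) / h') N K df h'0 evN K0 KN4.
move=> /(_ _ _) H.
have {}H : `|\sum_(i < N) f 1%N (jc R i * h') - 1 / h'| <=
   (h' / 4) ^+ K * (W * (expR (K%:R / 20) * M0 ^+ K)) + K%:R * (2 * expR (- K%:R) / h').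
  apply: H.
  - move=> z; rewrite /f normrM (ger0_norm kap0).
    have := psi_trig_der_bound 0 (expR (K%:R / 20)) M0 z (2 * K) K 0 0 (expR_ge0 _).
    rewrite normr0 add0r lexx expr0 mul1r => H.
    rewrite -[leRHS]mul1r ler_pM//; apply: H => //; last exact: KN2.
    move=> q qK; apply: (le_trans (psi_tail _ _ _ qK K0)).
    by rewrite ler_wpM2l ?exprn_ge0// ler_expR gerBl divr_ge0// sqr_ge0.
  - move=> k z1 z2 kK z1X z2X.
    rewrite [leRHS]mulrC divfK ?gt_eqF//.
    have z1n : W * h' / 4 <= `|z1| by rewrite (le_trans z1X)// ler_norm.
    have z2n : W * h' / 4 <= `|z2| by rewrite -normrN (le_trans _ (ler_norm _))// lerNr.
    case: k kK => [|k] kK.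
      rewrite expr0 mul1r /f.
      have e1 : `|Phi z1 - 1| <= expR (- K%:R).
        apply: (le_trans (Phi_tail_right _ (le_trans X1 z1X))).
        by rewrite ler_expR; have := zX _ z1n; have := K_ge1; lra.
      have e2 : `|Phi z2| <= expR (- K%:R).
        apply: (le_trans (Phi_tail_left _ _)); first by rewrite (le_trans z2X)// lerN2.
        by rewrite ler_expR; have := zX _ z2n; have := K_ge1; lra.
      have -> : Phi z1 - Phi z2 - 1 = (Phi z1 - 1) - Phi z2 by ring.
      apply: (le_trans (ler_normB _ _)); lra.
    rewrite subr0 /f.
    apply: (le_trans (ler_wpM2l (h4k _) (ler_normB _ _))); rewrite mulrDr.
    have := tailD k z1 (ltnW kK) z1n; have := tailD k z2 (ltnW kK) z2n; lra.
have -> : \sum_(i < N) h * (psi 0 (xgrid R i) * psi 0 (xgrid R i)) =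
    h' * \sum_(i < N) f 1%N (jc R i * h').
  rewrite mulr_sumr; apply: eq_bigr => i _.
  rewrite /f -pdfE normal_pdf01E.
  have -> : - (jc R i * h') ^+ 2 / 2 = - (xgrid R i ^+ 2).
    by rewrite exprMn h'2 xgridE; field.
  rewrite /h' !psiE /= !mulr1 mulrACA -expRD.
  have -> : - xgrid R i ^+ 2 / 2 + - xgrid R i ^+ 2 / 2 = - xgrid R i ^+ 2 by field.
  have -> : psi_norm 0 * psi_norm 0 = Num.sqrt 2 * (Num.sqrt (2 * pi))^-1 :> R.
    rewrite /psi_norm fact0 expr0 !mul1r -invfM -expr2 sqr_sqrtr ?sqrtr_ge0//.
    by rewrite sqrtrM// invfM mulrA divff ?mul1r// gt_eqF// sqrtr_gt0.
  by ring.
have -> : forall S : R, h' * S - 1 = h' * (S - 1 / h').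
  by move=> S; field; rewrite gt_eqF.
rewrite normrM (ger0_norm (ltW h'0)).
apply: (le_trans (ler_wpM2l (ltW h'0) H)).
have gd := geometric_decay _ K hM0 hM.
have E2 : expR (- K%:R) <= expR (- (K%:R / 19)) :> R.
  by rewrite ler_expR; have := K_ge1; lra.
have -> : h' * ((h' / 4) ^+ K * (W * (expR (K%:R / 20) * M0 ^+ K)) + K%:R * (2 * expR (- K%:R) / h')) =
   h' * W * ((h' / 4 * M0) ^+ K * expR (K%:R / 20)) + 2 * K%:R * expR (- K%:R).
  by rewrite (exprMn K (h' / 4) M0); field; rewrite gt_eqF.
have t1 : h' * W * ((h' / 4 * M0) ^+ K * expR (K%:R / 20)) <= 1 * W * expR (- (K%:R / 19)).
  apply: ler_pM => //.
  - by rewrite mulr_ge0// ltW.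
  - by rewrite mulr_ge0 ?expR_ge0// exprn_ge0.
  - by rewrite ler_wpM2r.
have t2 : 2 * K%:R * expR (- K%:R) <= 2 * W * expR (- (K%:R / 19)).
  apply: ler_pM => //; rewrite ?mulr_ge0 ?expR_ge0// ler_wpM2l//.
  by have := KN; have := K_ge1; lra.
lra.
Qed.

End Discrete.

(** * The inner product of grid vectors *)

Section Dot.
Local Open Scope sesquilinear_scope.
Context {R : realType} {N : nat}.
Local Notation C := (complex R).
Implicit Types (u v : 'cV[C]_N).

Definition cdot u v : C := \sum_i conjc (u i 0) * v i 0.

Lemma conjc_cR (x : R) : conjc (cR x) = cR x.
Proof. by rewrite /cR /= oppr0. Qed.

Lemma cdotDr u v w : cdot u (v + w) = cdot u v + cdot u w.
Proof. by rewrite -big_split; apply: eq_bigr => i _; rewrite mxE mulrDr. Qed.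

Lemma cdotZr (a : C) u v : cdot u (a *: v) = a * cdot u v.
Proof. by rewrite mulr_sumr; apply: eq_bigr => i _; rewrite mxE mulrCA. Qed.

Lemma cdotDl u v w : cdot (u + v) w = cdot u w + cdot v w.
Proof. by rewrite -big_split; apply: eq_bigr => i _; rewrite mxE rmorphD mulrDl. Qed.

Lemma cdotZl (a : C) u v : cdot (a *: u) v = conjc a * cdot u v.
Proof. by rewrite mulr_sumr; apply: eq_bigr => i _; rewrite mxE rmorphM mulrA. Qed.

Lemma cdot_suml n (u : 'I_n -> 'cV[C]_N) v : cdot (\sum_(i < n) u i) v = \sum_(i < n) cdot (u i) v.
Proof.
elim/big_rec2: _ => [|i z w _ <-]; last exact: cdotDl.
by rewrite /cdot big1// => i _; rewrite mxE conjc0 mul0r.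
Qed.

Lemma cdot_sumr n u (v : 'I_n -> 'cV[C]_N) : cdot u (\sum_(i < n) v i) = \sum_(i < n) cdot u (v i).
Proof.
elim/big_rec2: _ => [|i z w _ <-]; last exact: cdotDr.
by rewrite /cdot big1// => i _; rewrite mxE mulr0.
Qed.

Lemma cdot_hermitian (A : 'M[C]_N) u v : A^t* = A ->
  cdot (A *m u) v = cdot u (A *m v).
Proof.
move=> hA; rewrite /cdot.
under eq_bigr do rewrite mxE rmorph_sum mulr_suml.
under [RHS]eq_bigr do rewrite mxE mulr_sumr.
rewrite exchange_big; apply: eq_bigr => k _; apply: eq_bigr => i _.
by rewrite -[in RHS]hA !mxE rmorphM mulrAC mulrC mulrA.
Qed.

Lemma cdot_bound u v (a b : R) : 0 <= a -> (forall i, cmod (u i 0) <= a) ->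
  (forall i, cmod (v i 0) <= b) -> cmod (cdot u v) <= N%:R * (a * b).
Proof.
move=> a0 ua vb; apply: (le_trans (cmod_sum _ _ _ _)); apply: sum_le_const => i.
by rewrite cmodM cmod_conj ler_pM ?cmod_ge0.
Qed.

Lemma braketE u (M : 'M[C]_N) v : braket u M v = cdot u (M *m v).
Proof.
apply: eq_bigr => i _; rewrite mxE mulr_sumr; apply: eq_bigr => k _.
by rewrite mulrA.
Qed.

Lemma vnorm_sqr v : cR (vnorm v ^+ 2) = cdot v v.
Proof.
rewrite sqr_sqrtr; last by apply: sumr_ge0 => i _; rewrite addr_ge0 ?sqr_ge0.
rewrite cR_sum; apply: eq_bigr => i _; case: (v i 0) => a b /=.
by apply/eqP; rewrite eq_complex /=; apply/andP; split; apply/eqP; ring.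
Qed.

End Dot.

(** Meant for [x] the norm of a discrete superposition: |1 - x| (1 + x) <= d, and [x] is at least
    1/2. *)
Lemma inv_near1 {R : realType} (x d : R) : 0 <= x -> `|x ^+ 2 - 1| <= d -> d <= 1 / 2 ->
  `|x^-1| <= 2 /\ `|x^-1 - 1| <= 2 * d.
Proof.
move=> x0 xd d1.
have x2 : 1 / 2 <= x by move: xd; rewrite ler_norml; nra.
have xp : 0 < x by lra.
split.
  rewrite ger0_norm ?invr_ge0// -[2]invrK lef_pV2 ?posrE ?invr_gt0//; lra.
have -> : x^-1 - 1 = (1 - x) / x by field; rewrite gt_eqF.
rewrite normrM normfV (ger0_norm x0) ler_pdivrMr//.
have : `|1 - x| * (1 + x) <= d.
  rewrite -[1 + x]ger0_norm; last by lra.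
  by rewrite -normrM (_ : (1 - x) * (1 + x) = - (x ^+ 2 - 1)) ?normrN//; ring.
have := normr_ge0 (1 - x); nra.
Qed.

(** * Gram matrix and amplitudes of discrete superpositions *)

Section Assembly.
Local Open Scope sesquilinear_scope.
Context {R : realType} (N K N' : nat).
Hypotheses (K0 : (0 < K)%N) (evN : ~~ odd N)
  (KN : 150 * 200 * K%:R <= GRing.natmul (GRing.one R) N) (N'K : (N' + 3 <= K)%N).
Local Notation s := (@hcoef R).
Local Notation C := (complex R).
Local Notation W := (GRing.natmul (GRing.one R) N).
Local Notation h := (gstep (R := R) N).

(** Uniform constants for the indices up to [N'.+1]: [P] bounds the Hermite functions and [r] the
    residuals. The index beyond [N'] is needed because [gram_step] reaches [n.+2]. *)
Let P : R := 20 ^+ N'.+2.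
Let q : R := 10 ^+ N'.+2.
Let e : R := expR (- (K%:R / 19)).
Let r : R := 18 * W ^+ 4 * (q * e).

Let P1 : 1 <= P. Proof. by rewrite exprn_ege1// (ler_nat _ 1 20). Qed.
Let q1 : 1 <= q. Proof. by rewrite exprn_ege1// (ler_nat _ 1 10). Qed.
Let e0 : 0 < e. Proof. exact: expR_gt0. Qed.
Let W1 : 1 <= W. Proof. by have := N_ge N K K0 KN; lra. Qed.
Let P0 : 0 <= P := le_trans ler01 P1.
Let q0 : 0 <= q := le_trans ler01 q1.
Let r0 : 0 <= r.
Proof.
exact: mulr_ge0 (mulr_ge0 (ler0n R 18) (exprn_ge0 4 (ler0n R N))) (mulr_ge0 q0 (ltW e0)).
Qed.

Let N'W : 3 * N'%:R + 1 <= W.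
Proof.
have : ((N' + 3)%:R : R) <= K%:R by rewrite ler_nat.
rewrite natrD; have : 0 <= N'%:R :> R by []. have := KN; lra.
Qed.

Let N'1W : N'.+1%:R <= W.
Proof. by rewrite -natr1; have : 0 <= N'%:R :> R by []; have := N'W; lra. Qed.

Lemma psi_sup p (x : R) : `|psi p x| <= 20 ^+ p.+1.
Proof.
have Q0 : 0 < p.+1%:R :> R by [].
have := psi_bound 10 p.+1%:R x p (ltr0n _ 10) Q0 => H.
have {}H := H _; have pp : (p%:R : R) <= p.+1%:R by rewrite ler_nat.
apply: (le_trans (H pp)).
have -> : (20 : R) ^+ p.+1 = 10 ^+ p * (10 * 2 ^+ p.+1).
  by rewrite (_ : 20 = 10 * 2 :> R); [rewrite exprMn exprS; ring|ring].
rewrite ler_wpM2l ?exprn_ge0//.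
apply: (@le_trans _ _ (1 * 2 ^+ p.+1)); last by rewrite ler_wpM2r ?exprn_ge0// (ler_nat _ 1 10).
rewrite mul1r; apply: (@le_trans _ _ (expR (p.+1%:R * 20^-1))).
  rewrite ler_expR (_ : 5 * p.+1%:R / (2 * 10 ^+ 2) = p.+1%:R / 40 :> R); last by field.
  by have := sqr_ge0 x; lra.
rewrite expRM_natl lerXn2r ?nnegrE ?expR_ge0//.
apply: (le_trans expR_inv20); lra.
Qed.

Let psi_supP p (x : R) : (p <= N'.+1)%N -> `|psi p x| <= P.
Proof.
move=> pN; apply: (le_trans (psi_sup p x)).
by rewrite ler_weXn2l// (ler_nat _ 1 20).
Qed.

Let psid_sup p i : (p <= N'.+1)%N -> cmod (psid R N p i 0) <= P.
Proof.
move=> pN; rewrite mxE cmod_cR normrM -[P]mul1r.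
apply: ler_pM => //; last exact: psi_supP.
by rewrite ger0_norm ?quarter_ge0// (quarter_le1 N K K0 KN).
Qed.

Let resid p i : (p <= N'.+1)%N ->
  cmod ((Hd R N *m psid R N p - cR (p%:R + 2^-1) *: psid R N p) i 0) <= r.
Proof.
move=> pN; have pK : (p.+1 < K)%N by rewrite (leq_trans _ N'K)// addn3 !ltnS.
apply: (le_trans (Hd_residual N K K0 evN KN p i pK)).
rewrite /res /r ler_wpM2l ?mulr_ge0 ?exprn_ge0// ler_wpM2r ?expR_ge0//.
by rewrite ler_weXn2l// (ler_nat _ 1 10).
Qed.

Definition gram m n : R :=
  \sum_(i < N) h * (psi m (xgrid R i) * psi n (xgrid R i)).

Lemma gramE m n : cdot (psid R N m) (psid R N n) = cR (gram m n).
Proof.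
rewrite /gram cR_sum; apply: eq_bigr => i _; rewrite !mxE conjc_cR -cRM.
by rewrite -quarter_sqr; congr cR; ring.
Qed.

Let gam : R := 2 * W * (P * r).

Let gam0 : 0 <= gam.
Proof. exact: mulr_ge0 (mulr_ge0 (ler0n R 2) (ler0n R N)) (mulr_ge0 P0 r0). Qed.

(** Moving [Hd] across the inner product leaves (Em - En) times the Gram entry equal to inner
    products with residuals, and distinct eigenvalues differ by at least 1. *)
Lemma gram_offdiag m n : (m <= N'.+1)%N -> (n <= N'.+1)%N -> m != n ->
  `|gram m n| <= gam.
Proof.
move=> mN nN mn.
pose Em := m%:R + 2^-1 : R; pose En := n%:R + 2^-1 : R.
pose rm := Hd R N *m psid R N m - cR Em *: psid R N m.
pose rn := Hd R N *m psid R N n - cR En *: psid R N n.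
have Hm : Hd R N *m psid R N m = cR Em *: psid R N m + rm by rewrite addrC subrK.
have Hn : Hd R N *m psid R N n = cR En *: psid R N n + rn by rewrite addrC subrK.
have := cdot_hermitian (Hd R N) (psid R N m) (psid R N n) (Hd_hermitian N (N_nat_gt0 N K K0 KN)).
rewrite Hm Hn cdotDl cdotDr cdotZl cdotZr conjc_cR gramE => E.
have {}E : cR ((Em - En) * gram m n) = cdot (psid R N m) rn - cdot rm (psid R N n).
  apply: (addIr (cR En * cR (gram m n) + cdot rm (psid R N n))).
  rewrite cRM cRB.
  rewrite [LHS](_ : _ = cR Em * cR (gram m n) + cdot rm (psid R N n)); last by ring.
  by rewrite E; ring.
have b1 := cdot_bound (psid R N m) rn P r (le_trans ler01 P1) (fun i => psid_sup m i mN) (fun i => resid n i nN).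
have b2 := cdot_bound rm (psid R N n) r P r0 (fun i => resid m i mN) (fun i => psid_sup n i nN).
have : `|(Em - En) * gram m n| <= gam.
  rewrite -cmod_cR E (le_trans (cmodB _ _))// /gam; lra.
apply: le_trans; rewrite normrM ler_peMl//.
have -> : Em - En = (m%:Z - n%:Z)%:~R.
  by rewrite rmorphB /= /Em /En opprD addrACA subrr addr0.
rewrite -intr_norm (ler_int _ 1) -gtz0_ge1 normr_gt0 subr_eq0.
by apply: contra mn => /eqP [->].
Qed.

(** The grid sum of x psi_n psi_{n+1} is expanded in two ways, with x acting on either factor. The
    difference of the two diagonal entries is thus a combination of off-diagonal ones, with
    coefficient ratios at most 2 and 1. *)
Lemma gram_step n : (n.+2 <= N'.+1)%N ->
  `|gram n.+1 n.+1 - gram n n| <= 3 * gam.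
Proof.
move=> nN.
have E : s n.+1 * gram n.+1 n.+1 + s n * gram n.-1 n.+1 =
    s n.+2 * gram n n.+2 + s n.+1 * gram n n.
  rewrite /gram !mulr_sumr -!big_split; apply: eq_bigr => i _ /=.
  set x := xgrid R i.
  transitivity (h * ((x * psi n x) * psi n.+1 x)); first by rewrite mulx_psi; ring.
  transitivity (h * (psi n x * (x * psi n.+1 x))); first by ring.
  by rewrite mulx_psi /=; ring.
have s1 := hcoefS_gt0 (R := R) n.
have s0 : s n <= s n.+1 by exact: hcoef_mono.
have s2 : s n.+2 <= 2 * s n.+1.
  rewrite -(@ler_pXn2r _ 2) ?nnegrE ?mulr_ge0 ?hcoef_ge0// exprMn !hcoef_sqr -[n.+2%:R]natr1 -[n.+1%:R]natr1.
  by have : 0 <= n%:R :> R by []; lra.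
have g0 := gam0.
have b2 := gram_offdiag n n.+2 (ltnW (ltnW nN)) nN.
have {}b2 : `|gram n n.+2| <= gam by apply: b2; rewrite neq_ltn ltnS leqnSn.
have b1 : s n * `|gram n.-1 n.+1| <= s n.+1 * gam.
  case: n nN s0 {E s1 s2 b2} => [|n] nN s0.
    by rewrite hcoef0 mul0r mulr_ge0 ?hcoef_ge0.
  apply: ler_pM; rewrite ?hcoef_ge0//; apply: gram_offdiag.
  - by rewrite (leq_trans _ nN)// !leqW.
  - exact: ltnW.
  - by rewrite neq_ltn /= ltnS leqnSn.
have : s n.+1 * (gram n.+1 n.+1 - gram n n) = s n.+2 * gram n n.+2 - s n * gram n.-1 n.+1.
  by rewrite mulrBr; have := E; lra.
move=> /(congr1 Num.norm); rewrite normrM (ger0_norm (ltW s1)) => E2.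
rewrite -(ler_pM2l s1) E2 (le_trans (ler_normB _ _))//.
rewrite !normrM !(ger0_norm (hcoef_ge0 _)).
have := ler_pM (hcoef_ge0 n.+2) (normr_ge0 _) s2 b2.
lra.
Qed.

Let Gam : R := W * gam.

Let gam_ge : 3 * W * e <= gam.
Proof.
rewrite /gam /r.
have -> : 2 * W * (P * (18 * W ^+ 4 * (q * e))) = 36 * (W ^+ 4 * (P * q)) * (W * e) by ring.
rewrite -mulrA ler_wpM2r ?mulr_ge0 ?(ltW e0)//.
have : 1 <= W ^+ 4 * (P * q).
  by rewrite mulr_ege1 ?exprn_ege1// mulr_ege1.
lra.
Qed.

(** On the diagonal, [gram_step] propagates the base case [Gauss_grid]; the accumulated factor 3 m +
    1 is at most [N]. *)
Lemma gram_near m n : (m <= N')%N -> (n <= N')%N -> `|gram m n - (m == n)%:R| <= Gam.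
Proof.
move=> mN nN.
have g0 := gam0.
have [<-{n nN}|mn] := eqVneq m n; last first.
  rewrite subr0 (le_trans (gram_offdiag m n _ _ mn)) ?leqW//.
  by rewrite /Gam ler_peMl.
have diag k : (k <= N')%N -> `|gram k k - 1| <= (3 * k%:R + 1) * gam.
  elim: k => [_|k IH kN].
    rewrite mulr0 add0r mul1r; apply: le_trans gam_ge.
    exact: Gauss_grid N K K0 evN KN.
  have := gram_step k _; rewrite ltnS => /(_ kN) st.
  have -> : gram k.+1 k.+1 - 1 = (gram k.+1 k.+1 - gram k k) + (gram k k - 1) by ring.
  apply: (le_trans (ler_normD _ _)); apply: (le_trans (lerD st (IH (ltnW kN)))).
  by rewrite -[k.+1%:R]natr1; lra.
apply: (le_trans (diag m mN)); rewrite /Gam ler_wpM2r//.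
apply: le_trans N'W; rewrite lerD2r ler_wpM2l// ler_nat//.
Qed.

Definition superpos (c : nat -> C) : 'cV[C]_N := \sum_(n < N'.+1) c n *: psid R N n.

Definition phased (t : R) (c : nat -> C) (n : nat) : C :=
  c n * expi (- ((n%:R + 2^-1) * t)).

Let small (c : nat -> C) := forall n, (n <= N')%N -> cmod (c n) <= 1.

Lemma normalized_small c : normalized N' c -> small c.
Proof.
move=> nc n nN.
have : cmod (c n) ^+ 2 <= 1.
  rewrite cmod_sqr -nc (bigD1 (Ordinal (nN : (n < N'.+1)%N)))//= lerDl.
  by rewrite sumr_ge0// => i _; rewrite addr_ge0 ?sqr_ge0.
by rewrite -[leRHS](expr1n _ 2) ler_pXn2r ?nnegrE ?cmod_ge0.
Qed.

Lemma phased_small t c : small c -> small (phased t c).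
Proof. by move=> sc n nN; rewrite cmodM cmod_expi mulr1 sc. Qed.

Lemma superpos_sup c i : small c -> cmod (superpos c i 0) <= W * P.
Proof.
move=> sc; rewrite summxE (le_trans (cmod_sum _ _ _ _))//.
apply: (@le_trans _ _ (N'.+1%:R * P)); last by rewrite ler_wpM2r// (le_trans ler01 P1).
apply: sum_le_const => n; rewrite mxE cmodM -[P]mul1r.
have nN : (n <= N')%N by rewrite -ltnS.
by apply: ler_pM; rewrite ?cmod_ge0 ?sc// psid_sup// leqW.
Qed.

(** Expanding both sides, the error is a sum of at most N^2 Gram defects with coefficients of
    modulus at most 1. *)
Lemma cdot_superpos a b : small a -> small b ->
  cmod (cdot (superpos a) (superpos b) - \sum_(n < N'.+1) conjc (a n) * b n) <= W ^+ 2 * Gam.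
Proof.
move=> sa sb.
have G0 : 0 <= Gam := mulr_ge0 (ler0n R N) gam0.
have -> : cdot (superpos a) (superpos b) - \sum_(n < N'.+1) conjc (a n) * b n =
    \sum_(m < N'.+1) \sum_(n < N'.+1) conjc (a m) * b n * cR (gram m n - (m == n)%:R).
  rewrite cdot_suml -sumrB; apply: eq_bigr => m _.
  rewrite cdotZl cdot_sumr.
  have -> : conjc (a m) * b m = \sum_(n < N'.+1) conjc (a m) * b n * cR (m == n)%:R.
    rewrite (bigD1 m)//= eqxx mulr1 big1 ?addr0// => n nm.
    by rewrite (_ : (m == n) = false) ?mulr0//; apply/negbTE; rewrite eq_sym.
  rewrite mulr_sumr -sumrB; apply: eq_bigr => n _.
  by rewrite cdotZr gramE cRB mulrBr mulrA.
rewrite (le_trans (cmod_sum _ _ _ _))//.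
apply: (@le_trans _ _ (N'.+1%:R * (N'.+1%:R * Gam))).
  apply: sum_le_const => m; rewrite (le_trans (cmod_sum _ _ _ _))//.
  apply: sum_le_const => n; rewrite !cmodM cmod_conj cmod_cR.
  have mN : (m <= N')%N by rewrite -ltnS.
  have nN : (n <= N')%N by rewrite -ltnS.
  rewrite -[Gam]mul1r; apply: ler_pM; rewrite ?mulr_ge0 ?cmod_ge0//; last exact: gram_near.
  by rewrite mulr_ile1 ?cmod_ge0 ?sa ?sb.
rewrite expr2 -mulrA; apply: ler_pM => //; first exact: mulr_ge0.
by rewrite ler_wpM2r.
Qed.

Lemma evolution_superpos c t i : small c ->
  cmod ((Ud N t *m superpos c - superpos (phased t c)) i 0) <= 2 * `|t| * W ^+ 3 * r.
Proof.
move=> sc.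
have -> : Ud N t *m superpos c - superpos (phased t c) =
   \sum_(n < N'.+1) c n *: (Ud N t *m psid R N n - expi (- ((n%:R + 2^-1) * t)) *: psid R N n).
  rewrite mulmx_sumr -sumrB; apply: eq_bigr => n _.
  by rewrite -scalemxAr scalerBr scalerA.
rewrite summxE (le_trans (cmod_sum _ _ _ _))//.
have t0 : 0 <= 2 * `|t| * W ^+ 2 * r.
  exact: mulr_ge0 (mulr_ge0 (mulr_ge0 (ler0n R 2) (normr_ge0 t)) (exprn_ge0 2 (ler0n R N))) r0.
apply: (@le_trans _ _ (N'.+1%:R * (2 * `|t| * W ^+ 2 * r))); last first.
  have -> : 2 * `|t| * W ^+ 3 * r = W * (2 * `|t| * W ^+ 2 * r) by ring.
  by rewrite ler_wpM2r.
apply: sum_le_const => n; rewrite mxE cmodM -[leRHS]mul1r.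
have nN : (n <= N')%N by rewrite -ltnS.
apply: ler_pM; rewrite ?cmod_ge0 ?sc//.
apply: evolution_bound; first exact: Hd_hermitian N (N_nat_gt0 N K K0 KN).
by move=> k; apply: resid; rewrite leqW.
Qed.

(** A common majorant of all error terms, in which [N] occurs to powers below 10. The second factor
    [P] comes from [case_position], where the normalization error multiplies a vector entry. *)
Definition errbound : R := W ^+ 10 * (P * P * q) * e.

Let powW k : (k <= 10)%N -> W ^+ k <= W ^+ 10.
Proof. by move=> k10; rewrite ler_weXn2l. Qed.

Let Lam0 : 0 <= errbound.
Proof.
exact: mulr_ge0 (mulr_ge0 (exprn_ge0 10 (ler0n R N)) (mulr_ge0 (mulr_ge0 P0 P0) q0)) (ltW e0).
Qed.

Let err_pow (k : nat) (x : R) : (k <= 10)%N -> 0 <= x -> x <= P * P * q -> W ^+ k * x * e <= errbound.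
Proof.
move=> k10 x0 xP; rewrite /errbound ler_wpM2r ?(ltW e0)//.
by apply: ler_pM; rewrite ?exprn_ge0 ?powW.
Qed.

Let Pq0 : [/\ 0 <= P, 0 <= q, P * q <= P * P * q & q <= P * P * q].
Proof.
have p0 := P0; have q0' := q0.
have a : P * q <= P * P * q by rewrite ler_wpM2r// ler_peMl.
by split => //; apply: le_trans a; rewrite ler_peMl.
Qed.

Lemma norm_superpos c : normalized N' c -> 36 * errbound <= 1 / 2 ->
  let nu := (vnorm (superpos c))^-1 in
  `|nu| <= 2 /\ `|nu - 1| <= 72 * (W ^+ 8 * (P * q) * e).
Proof.
move=> nc sm nu.
have sc := normalized_small c nc.
have [p0 q0p Pq Pq2] := Pq0.
have := cdot_superpos c c sc sc.
rewrite -vnorm_sqr.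
have -> : \sum_(n < N'.+1) conjc (c n) * c n = cR 1.
  rewrite -nc cR_sum; apply: eq_bigr => n _; case: (c n) => a b.
  by rewrite /cR /=; apply/eqP; rewrite eq_complex /=; apply/andP; split; apply/eqP; ring.
rewrite -cRB cmod_cR.
have -> : W ^+ 2 * Gam = 36 * (W ^+ 8 * (P * q) * e) by rewrite /Gam /gam /r; ring.
move=> H; have [|a b] := inv_near1 _ _ (sqrtr_ge0 _) H.
  apply: le_trans sm; rewrite ler_wpM2l//.
  by apply: err_pow => //; rewrite mulr_ge0.
by split => //; apply: (le_trans b); lra.
Qed.

(** The unnormalized amplitude differs from its limit by the evolution error and the Gram defect, at
    most 36 (1 + |t|) [errbound]. Both normalizations together are at most 4 and within 216 of the
    basic error from 1, and 4 * 36 + 216 = 360. *)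
Lemma case_states c c' t : normalized N' c -> normalized N' c' ->
  36 * errbound <= 1 / 2 ->
  cmod (braket (phid N N' c') (Ud N t) (phid N N' c) -
    \sum_(n < N'.+1) conjc (c' n) * phased t c n) <= 360 * (1 + `|t|) * errbound.
Proof.
move=> nc nc' sm.
have sc := normalized_small c nc; have sc' := normalized_small c' nc'.
have [p0 q0p Pq Pq2] := Pq0.
have [a1 a2] := norm_superpos c nc sm; have [b1 b2] := norm_superpos c' nc' sm.
set w := \sum_(n < N'.+1) _.
pose al := (vnorm (superpos c))^-1; pose be := (vnorm (superpos c'))^-1.
rewrite -/al in a1 a2; rewrite -/be in b1 b2.
set X := cdot (superpos c') (Ud N t *m superpos c).
have -> : braket (phid N N' c') (Ud N t) (phid N N' c) - w = cR (be * al) * (X - w) + cR (be * al - 1) * w.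
  rewrite braketE /phid /normalize -/(superpos c) -/(superpos c') -/al -/be.
  by rewrite -scalemxAr cdotZr cdotZl conjc_cR -/X cRB cRM cR1; ring.
have Xw : cmod (X - w) <= 36 * (1 + `|t|) * errbound.
  have -> : X - w = cdot (superpos c') (Ud N t *m superpos c - superpos (phased t c)) +
     (cdot (superpos c') (superpos (phased t c)) - w).
    by rewrite addrA -cdotDr subrK.
  apply: (le_trans (cmodD _ _)).
  have d1 := cdot_superpos c' (phased t c) sc' (phased_small t c sc).
  have d2 := cdot_bound (superpos c') (Ud N t *m superpos c - superpos (phased t c)) _ _
    (mulr_ge0 (ler0n _ _) p0) (fun i => superpos_sup c' i sc') (fun i => evolution_superpos c t i sc).
  apply: (le_trans (lerD d2 d1)).
  have -> : W ^+ 2 * Gam = 36 * (W ^+ 8 * (P * q) * e) by rewrite /Gam /gam /r; ring.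
  have -> : W * (W * P * (2 * `|t| * W ^+ 3 * r)) = 36 * `|t| * (W ^+ 9 * (P * q) * e) by rewrite /r; ring.
  have Pq00 : 0 <= P * q by rewrite mulr_ge0.
  have f1 := err_pow 8 (P * q) isT Pq00 Pq; have f2 := err_pow 9 (P * q) isT Pq00 Pq.
  have := ler_wpM2l (normr_ge0 t) f2; lra.
have ab : `|be * al| <= 4.
  by rewrite normrM (_ : 4 = 2 * 2); [exact: ler_pM|ring].
have ab1 : `|be * al - 1| <= 216 * (W ^+ 8 * (P * q) * e).
  have -> : be * al - 1 = be * (al - 1) + (be - 1) by ring.
  apply: (le_trans (ler_normD _ _)); rewrite normrM.
  by have := ler_pM (normr_ge0 be) (normr_ge0 _) b1 a2; lra.
have w1 : cmod w <= W.
  apply: (le_trans (cmod_sum _ _ _ _)); apply: (@le_trans _ _ (N'.+1%:R * 1)); last by rewrite mulr1.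
  apply: sum_le_const => n; have nN : (n <= N')%N by rewrite -ltnS.
  by rewrite cmodM cmod_conj mulr_ile1 ?cmod_ge0 ?sc'//; exact: phased_small.
apply: (le_trans (cmodD _ _)); rewrite !cmodM !cmod_cR.
have g1 := ler_pM (normr_ge0 _) (cmod_ge0 _) ab Xw.
have g2 := ler_pM (normr_ge0 _) (cmod_ge0 _) ab1 w1.
apply: (le_trans (lerD g1 g2)).
have -> : 216 * (W ^+ 8 * (P * q) * e) * W = 216 * (W ^+ 9 * (P * q) * e) by ring.
have f2 := err_pow 9 (P * q) isT (mulr_ge0 p0 q0) Pq.
have := mulr_ge0 (normr_ge0 t) Lam0; have := Lam0; lra.
Qed.

(** The bra [ket R j] selects one entry, so the entrywise evolution bound is used directly and only
    one normalization enters. *)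
Lemma case_position c t (j : 'I_N) : normalized N' c ->
  36 * errbound <= 1 / 2 ->
  cmod (braket (ket R j) (Ud N t) (phid N N' c) -
    superpos (phased t c) j 0) <= 360 * (1 + `|t|) * errbound.
Proof.
move=> nc sm.
have sc := normalized_small c nc.
have [p0 q0p Pq Pq2] := Pq0.
have [a1 a2] := norm_superpos c nc sm.
pose al := (vnorm (superpos c))^-1; rewrite -/al in a1 a2.
have -> : braket (ket R j) (Ud N t) (phid N N' c) = cR al * (Ud N t *m superpos c) j 0.
  rewrite braketE /phid /normalize -/(superpos c) -/al -scalemxAr cdotZr; congr (_ * _).
  rewrite /cdot (bigD1 j)//= mxE eqxx conjc1 mul1r big1 ?addr0// => i ij.
  by rewrite mxE (negbTE ij) conjc0 mul0r.
have -> : cR al * (Ud N t *m superpos c) j 0 - superpos (phased t c) j 0 =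
   cR al * (Ud N t *m superpos c - superpos (phased t c)) j 0 + cR (al - 1) * superpos (phased t c) j 0.
  have -> : (Ud N t *m superpos c - superpos (phased t c)) j 0 =
     (Ud N t *m superpos c) j 0 - superpos (phased t c) j 0 by rewrite [LHS]mxE [X in _ + X]mxE.
  by rewrite cRB cR1; ring.
apply: (le_trans (cmodD _ _)); rewrite !cmodM !cmod_cR.
have g1 := ler_pM (normr_ge0 _) (cmod_ge0 _) a1 (evolution_superpos c t j sc).
have g2 := ler_pM (normr_ge0 _) (cmod_ge0 _) a2 (superpos_sup (phased t c) j (phased_small t c sc)).
apply: (le_trans (lerD g1 g2)).
have -> : 2 * (2 * `|t| * W ^+ 3 * r) = 72 * `|t| * (W ^+ 7 * q * e) by rewrite /r; ring.
have -> : 72 * (W ^+ 8 * (P * q) * e) * (W * P) = 72 * (W ^+ 9 * (P * P * q) * e) by ring.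
have f1 := err_pow 7 q isT q0 Pq2.
have f2 := err_pow 9 (P * P * q) isT (mulr_ge0 (mulr_ge0 p0 p0) q0) (lexx _).
have := ler_wpM2l (normr_ge0 t) f1.
have := mulr_ge0 (normr_ge0 t) Lam0; have := Lam0; lra.
Qed.

(** No error arises here: discrete states are exact samples of the wave functions. *)
Lemma superpos_evolved c t (j : 'I_N) :
  superpos (phased t c) j 0 = cR (quarter_factor R N) * evolved N' c t (xgrid R j).
Proof.
rewrite summxE /evolved mulr_sumr; apply: eq_bigr => n _.
by rewrite !mxE cRM /phased; ring.
Qed.

End Assembly.

(** * Comparison with the continuous oscillator *)

Section Continuous.
Local Open Scope sesquilinear_scope.
Context {R : realType}.
Local Notation C := (complex R).

Lemma Re_sum n (z : 'I_n -> C) : complex.Re (\sum_(i < n) z i) = \sum_(i < n) complex.Re (z i).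
Proof. by elim/big_rec2: _ => // i x y _ <-; case: (z i); case: y. Qed.

Lemma Im_sum n (z : 'I_n -> C) : complex.Im (\sum_(i < n) z i) = \sum_(i < n) complex.Im (z i).
Proof. by elim/big_rec2: _ => // i x y _ <-; case: (z i); case: y. Qed.

(** Orthonormality collapses the double sum. Real and imaginary parts are integrated separately in
    [L2inner]; [part] treats both through an additive, real-homogeneous [T]. *)
Lemma L2inner_psi N' (a b : nat -> C) (f g : R -> C) :
  (forall x, f x = \sum_(n < N'.+1) a n * cR (psi n x)) ->
  (forall x, g x = \sum_(n < N'.+1) b n * cR (psi n x)) ->
  L2inner f g = \sum_(n < N'.+1) conjc (a n) * b n.
Proof.
move=> fE gE.
have prodE x : conjc (f x) * g x =
    \sum_(m < N'.+1) \sum_(n < N'.+1) conjc (a m) * b n * cR (psi m x * psi n x).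
  rewrite fE gE rmorph_sum mulr_suml; apply: eq_bigr => m _.
  rewrite mulr_sumr; apply: eq_bigr => n _.
  have cM (z w : C) : conjc (z * w) = conjc z * conjc w by exact: rmorphM.
  by rewrite -[X in X * _]/(conjc (a m * cR (psi m x))) cM conjc_cR cRM; ring.
have dbl (z : nat -> nat -> R) :
    Rintegral lebesgue_measure setT
      (fun x : R => \sum_(m < N'.+1) \sum_(n < N'.+1) z m n * (psi m x * psi n x)) =
    \sum_(n < N'.+1) z n n.
  have inn (m : 'I_N'.+1) := Rintegral_sum_lin N'.+1 (fun n => z m n)
    (fun n x => psi m x * psi n x) (fun n => integrable_psi2 m n).
  have := Rintegral_sum_lin N'.+1 (fun=> 1)
    (fun m x => \sum_(n < N'.+1) z m n * (psi m x * psi n x)) (fun m => (inn m).1).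
  move=> [_]; under eq_fun do under eq_bigr do rewrite mul1r.
  move=> ->; apply: eq_bigr => m _; rewrite mul1r (inn m).2.
  rewrite (bigD1 m)//= big1 ?addr0 => [|n nm].
    by rewrite -/(psi_dot m m) psi_orthonormal eqxx mulr1.
  rewrite -/(psi_dot m n) psi_orthonormal (_ : (m == n :> nat) = false) ?mulr0//.
  by apply/negbTE; rewrite eq_sym; exact: nm.
have part (T : C -> R) : (forall n (z : 'I_n -> C), T (\sum_(i < n) z i) = \sum_(i < n) T (z i)) ->
    (forall z x, T (z * cR x) = T z * x) ->
    Rintegral lebesgue_measure setT (fun x => T (conjc (f x) * g x)) =
    T (\sum_(n < N'.+1) conjc (a n) * b n).
  move=> TS TM; rewrite TS -(dbl (fun m n => T (conjc (a m) * b n))).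
  congr Rintegral; apply/funext => x; rewrite prodE TS; apply: eq_bigr => m _.
  by rewrite TS; apply: eq_bigr => n _; rewrite TM.
rewrite /L2inner !part; first by case: (\sum_(n < N'.+1) _).
- exact: Im_sum.
- by move=> [u v] x; rewrite /cR /= mulr0 add0r.
- exact: Re_sum.
- by move=> [u v] x; rewrite /cR /= mulr0 subr0.
Qed.

End Continuous.

(** * Choice of the dimension and conclusion *)

(** The decay K / 19 is split into two halves K / 38. The first absorbs N^10 through 1 + K / 380 <=
    exp (K / 380), the second equals 12 (N' + 2) + m, and 20 * 20 * 10 <= 2^12 <= exp 12. *)
Lemma errbound_le {R : realType} (N K N' m : nat) :
  N%:R = 150 * 200 * K%:R :> R -> K = (38 * (12 * N'.+2 + m))%N ->
  errbound N K N' <= (150 * 200 * 380) ^+ 10 * expR (- m%:R) :> R.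
Proof.
move=> NE KE; rewrite /errbound NE.
set k := K%:R; have k0 : 0 <= k by [].
have kE : k / 38 = N'.+2%:R * 12 + m%:R.
  by rewrite /k KE natrM natrD natrM; field.
have W10 : (150 * 200 * k) ^+ 10 <= (150 * 200 * 380) ^+ 10 * expR (k / 38).
  have -> : k / 38 = 10%:R * (k / 380) by field.
  have e1 := expR_ge1Dx (k / 380).
  by rewrite expRM_natl -exprMn; apply: lerXn2r; rewrite ?nnegrE; lra.
have PP : 20 ^+ N'.+2 * 20 ^+ N'.+2 * 10 ^+ N'.+2 <= expR (N'.+2%:R * 12) :> R.
  rewrite -!exprMn expRM_natl lerXn2r ?nnegrE ?expR_ge0//.
  have -> : (12 : R) = 12%:R * 1 by ring.
  rewrite expRM_natl; apply: (@le_trans _ _ (2 ^+ 12)); first by lra.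
  by rewrite lerXn2r ?nnegrE ?expR_ge0//; have := expR_ge1Dx (1 : R); lra.
have -> : expR (- (k / 19)) = expR (- (k / 38)) * (expR (- (N'.+2%:R * 12)) * expR (- m%:R)).
  by rewrite -!expRD; congr expR; have := kE; lra.
have P0 : 0 <= 20 ^+ N'.+2 * 20 ^+ N'.+2 * 10 ^+ N'.+2 :> R.
  exact: mulr_ge0 (mulr_ge0 (exprn_ge0 _ (ler0n R 20)) (exprn_ge0 _ (ler0n R 20)))
    (exprn_ge0 _ (ler0n R 10)).
have W0 : 0 <= (150 * 200 * k) ^+ 10 by apply: exprn_ge0; lra.
have := ler_pM W0 P0 W10 PP.
move=> /(ler_wpM2r (mulr_ge0 (expR_ge0 (- (k / 38))) (mulr_ge0 (expR_ge0 (- (N'.+2%:R * 12))) (expR_ge0 (- m%:R))))) H.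
apply: (le_trans H); rewrite le_eqVlt; apply/orP; left; apply/eqP.
transitivity ((150 * 200 * 380) ^+ 10 * (expR (k / 38) * expR (- (k / 38))) *
  (expR (N'.+2%:R * 12) * expR (- (N'.+2%:R * 12))) * expR (- m%:R) : R); first by ring.
by rewrite -!expRD !subrr expR0 !mulr1.
Qed.

Theorem theorem1 (R : realType) (T : R) :
  exists C1 : R, exists C2 : R, exists eps0 : R,
  0 < C1 /\ 0 < C2 /\ 0 < eps0 /\
  forall (N' : nat) (c c' : nat -> complex R) (t eps : R),
    normalized N' c -> normalized N' c' ->
    1 < `|t| -> `|t| <= T -> 0 < eps -> eps < eps0 ->
    (* case 1: phi' = sum_n c'_n |psi_n> *)
    (exists N : nat, (2 <= N)%N /\ ~~ odd N /\
       N%:R <= C1 * (ln (eps^-1) + N'%:R) /\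
       cmod (braket (phid N N' c') (Ud N t) (phid N N' c)
             - L2inner (wavefun N' c') (evolved N' c t)) <= C2 * eps) /\
    (* case 2: phi' = (2 pi/N)^{1/4} |x_j>, phi'^d = |j>, for any grid index j *)
    (exists N : nat, (2 <= N)%N /\ ~~ odd N /\
       N%:R <= C1 * (ln (eps^-1) + N'%:R) /\
       forall j : 'I_N,
       cmod (braket (ket R j) (Ud N t) (phid N N' c)
             - cR (quarter_factor R N) * evolved N' c t (xgrid R j)) <= C2 * eps).
Proof.
have [C0 C0E] : exists C0 : R, C0 = (150 * 200 * 380) ^+ 10 by exists ((150 * 200 * 380) ^+ 10).
have C00 : 0 < C0 by rewrite C0E; apply: exprn_gt0; lra.
(* In the threshold for [eps], exp (- 1) ensures ln (1 / eps) >= 1, and 1 / (72 C0) ensures 36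
   [errbound] <= 1/2, as the normalization needs. *)
exists (150 * 200 * 1300), (360 * (1 + `|T|) * C0), (Num.min (expR (- 1)) (1 / (72 * C0))).
split; first by lra.
split; first by apply: mulr_gt0 C00; have := normr_ge0 T; lra.
split; first by rewrite lt_min expR_gt0 divr_gt0// mulr_gt0.
move=> N' c c' t eps nc nc' _ tT eps0; rewrite lt_min => /andP[eps1 eps2].
pose L := ln eps^-1.
have L1 : 1 <= L.
  rewrite -ler_expR lnK ?posrE ?invr_gt0// -[expR 1]invrK -expRN.
  by rewrite lef_pV2 ?posrE ?expR_gt0// ltW.
have [m /andP[Lm mL]] : exists m : nat, L <= m%:R <= L + 1.
  exists (Num.truncn L).+1.
  have L0 : 0 <= L by lra.
  by have := truncn_itv L0; rewrite -natr1; lra.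
(* [exp (- K / 38)] beats the powers of [N], the other half of [exp (- K / 19)]
   the powers of [20] and [10] and leaves [exp (- m) <= eps]. *)
pose K := (38 * (12 * N'.+2 + m))%N.
pose N := (2 * (75 * 200 * K))%N.
have NE : N%:R = 150 * 200 * K%:R :> R by rewrite /N !natrM; ring.
have K3 : (N' + 3 <= K)%N.
  apply: (@leq_trans (1 * (12 * N'.+2 + m))); last by rewrite leq_mul2r orbT.
  rewrite mul1n (leq_trans _ (leq_addr _ _))// addn3.
  by rewrite -[X in (X < _)%N]mul1n ltn_pmul2r.
have K0 : (0 < K)%N by apply: leq_trans K3; rewrite addn3.
have evN : ~~ odd N by rewrite oddM.
have N2 : (2 <= N)%N by rewrite leq_pmulr// !muln_gt0.
(* As m <= L + 1 and L >= 1, K is at most 988 L + 456 N'. *)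
have NC : N%:R <= 150 * 200 * 1300 * (L + N'%:R).
  rewrite NE /K natrM natrD natrM -[N'.+2%:R]natr1 -[N'.+1%:R]natr1.
  have : 0 <= N'%:R :> R by [].
  lra.
have KN : 150 * 200 * K%:R <= GRing.natmul (GRing.one R) N by rewrite -NE.
(* Here exp (- m) <= exp (- L) = eps. *)
have Le : errbound N K N' <= C0 * eps.
  apply: (le_trans (errbound_le N K N' m NE erefl)); rewrite -C0E ler_pM2l//.
  rewrite -[eps]lnK ?posrE// ler_expR lerNl -lnV ?posrE//.
have sm : 36 * errbound N K N' <= 1 / 2 :> R.
  apply: (@le_trans _ _ (36 * (C0 * eps))); first by rewrite ler_pM2l.
  have : 72 * C0 * eps < 1 by rewrite -ltr_pdivlMl ?mulr_gt0// mulr1 -div1r.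
  lra.
have bnd x : x <= 360 * (1 + `|t|) * errbound N K N' -> x <= 360 * (1 + `|T|) * C0 * eps.
  move=> /le_trans; apply; have t0 := normr_ge0 t.
  apply: (@le_trans _ _ (360 * (1 + `|t|) * (C0 * eps))).
    by apply: ler_wpM2l Le; lra.
  rewrite -[leRHS]mulrA; apply: ler_wpM2r; first exact: ltW (mulr_gt0 C00 eps0).
  by have := le_trans tT (ler_norm T); lra.
split; exists N; split=> //; split=> //; split=> //.
  apply: bnd.
  rewrite (L2inner_psi N' c' (phased t c)) //.
  exact: (case_states N K N').
move=> j; apply: bnd; rewrite -superpos_evolved.
exact: (case_position N K N').
Qed.
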